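(* Let $k\ge 3$ and let $F_k$ be the free group on $\gamma_1,\dots,\gamma_k$. The $8k-8$ trace functions $$\mathcal T=\big(\tau_1,\tau_{\bar1},\tau_2,\tau_{\bar2},\dots,\tau_k,\tau_{\bar k},\ \tau_{12},\tau_{\bar1\bar2},\tau_{13},\tau_{\bar1\bar3},\dots,\tau_{1k},\tau_{\bar1\bar k},\ \tau_{23},\tau_{\bar2\bar3},\dots,\tau_{2k},\tau_{\bar2\bar k},\ \tau_{1\bar2},\tau_{\bar12},\tau_{1\bar3},\tau_{\bar13},\dots,\tau_{1\bar k},\tau_{\bar1k}\big)$$ define a local parameterization $$\mathcal T\colon\mathcal R^*(F_k,\mathrm{SL}_3(\mathbb C))\setminus\operatorname{crit}(\mathcal T)\to\mathbb C^{8k-8},$$ where $$\operatorname{crit}(\mathcal T)=\bigcup_{i=2}^k\{\tau_{1i\bar1\bar i}=\tau_{i1\bar i\bar1}\}\cup\bigcup_{i=3}^k\{\varDelta^1_{2i}=0\},$$ $$\varDelta^1_{2i}=(\tau_{12i}-\tau_{1i2})(\tau_{\bar1\bar2\bar i}-\tau_{\bar1\bar i\bar2})-(\tau_{1\bar2\bar i}-\tau_{1\bar i\bar2})(\tau_{\bar12i}-\tau_{\bar1i2}).$$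
   Context: $\tau_{i_1\cdots i_l}$ is the function $[\rho]\mapsto\operatorname{tr}\rho(\gamma_{i_1}\cdots\gamma_{i_l})$, with the convention $\gamma_{\bar i}=\gamma_i^{-1}$. A representation $\rho\colon F_k\to\mathrm{SL}_3(\mathbb C)$ is good if its image is contained in no proper parabolic subgroup (i.e. it is irreducible) and its centralizer is the center of $\mathrm{SL}_3(\mathbb C)$. $\mathcal R^*(F_k,\mathrm{SL}_3(\mathbb C))$ is the set of conjugacy classes of good representations, a complex manifold of dimension $8k-8$. A local parameterization is a holomorphic map that is a local biholomorphism at every point (its components are local coordinates). *)

(* Defs.v *)
From HB Require Import structures.
From mathcomp Require Import all_boot all_order all_algebra.
From mathcomp Require Import complex zify.
From mathcomp Require Import all_classical all_reals all_analysis.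
Set Implicit Arguments.
Unset Strict Implicit.
Unset Printing Implicit Defensive.
Import Order.TTheory GRing.Theory Num.Theory.
Import numFieldNormedType.Exports.
Local Open Scope classical_set_scope.
Local Open Scope ring_scope.

(* The sort of a numClosedFieldType carries the topology and normed structure
   of MathComp-Analysis; differentiability over it is complex differentiability. *)
Definition Cplx (R : realType) : numClosedFieldType := R[i].

Section SL3.
Variable C : fieldType.

Record SL3 := MkSL3 { slmx :> 'M[C]_3; _ : \det slmx == 1 }.

HB.instance Definition _ := [isSub for slmx].
HB.instance Definition _ := [Choice of SL3 by <:].

Lemma det_slmx (A : SL3) : \det (slmx A) = 1.
Proof. by case: A => A /= /eqP. Qed.

Lemma slmx_unit (A : SL3) : slmx A \in unitmx.
Proof. by rewrite unitmxE det_slmx unitr1. Qed.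

Fact sl_one_subproof : \det (1%:M : 'M[C]_3) == 1.
Proof. by rewrite det1. Qed.
Fact sl_mul_subproof (A B : SL3) : \det (slmx A *m slmx B) == 1.
Proof. by rewrite det_mulmx !det_slmx mulr1. Qed.
Fact sl_inv_subproof (A : SL3) : \det (invmx (slmx A)) == 1.
Proof. by rewrite det_inv det_slmx invr1. Qed.

Definition sl_one := MkSL3 sl_one_subproof.
Definition sl_mul A B := MkSL3 (sl_mul_subproof A B).
Definition sl_inv A := MkSL3 (sl_inv_subproof A).

Fact sl_mulA : associative sl_mul.
Proof. by move=> A B D; apply/val_inj; rewrite /= mulmxA. Qed.
Fact sl_mul1 : left_id sl_one sl_mul.
Proof. by move=> A; apply/val_inj; rewrite /= mul1mx. Qed.
Fact sl_mulr1 : right_id sl_one sl_mul.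
Proof. by move=> A; apply/val_inj; rewrite /= mulmx1. Qed.
Fact sl_mulV : left_inverse sl_one sl_inv sl_mul.
Proof. by move=> A; apply/val_inj; rewrite /= mulVmx ?slmx_unit. Qed.
Fact sl_mulrV : right_inverse sl_one sl_inv sl_mul.
Proof. by move=> A; apply/val_inj; rewrite /= mulmxV ?slmx_unit. Qed.

HB.instance Definition _ :=
  isGroup.Build SL3 sl_mulA sl_mul1 sl_mulr1 sl_mulV sl_mulrV.

(* The elements of a flag are row spaces, on which matrices act on the right.
   Passing to annihilators, these stabilizers are the same subgroups as the
   stabilizers of flags of column spaces. *)
Definition parabolic (P : set SL3) : Prop :=
  exists2 s : seq 'M[C]_3, sorted (fun U V => (U < V)%MS) s &
    P = [set A | forall U, U \in s -> stablemx U (slmx A)].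

End SL3.

(* Universal property of the free group on the family gam. *)
Definition free_basis (k : nat) (F : groupType) (gam : k.-tuple F) : Prop :=
  forall (H : groupType) (h : k.-tuple H),
    exists! f : {multiplicative F -> H}, map_tuple f gam = h.

Section CharacterManifold.
Variables (R : realType) (k : nat) (F : groupType) (gam : k.-tuple F).
Local Notation C := (Cplx R).
Local Notation hom := {multiplicative F -> SL3 C}.

HB.instance Definition _ := gen_eqMixin hom.
HB.instance Definition _ := gen_choiceMixin hom.

(* Hom(F_k, SL_3) as the submanifold SL_3^k of the space of k-tuples of 3x3
   matrices, the i-th matrix being stored as the i-th row. *)
Definition coords (rho : hom) : 'M[C]_(k, 3 * 3) :=
  \matrix_(i < k) mxvec (slmx (rho (tnth gam i))).

Definition Hom := initial_topology coords.

Definition good : set Hom := [set rho : hom |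
  (forall P : set (SL3 C), parabolic P -> P <> setT -> ~ (range rho `<=` P))
  /\ [set A : SL3 C | forall x, commute A (rho x)]
     = [set A : SL3 C | forall B, commute A B]].

Definition goodHom : Type := good.
HB.instance Definition _ := Topological.on goodHom.

Definition ghom (rho : goodHom) : hom := set_val rho.

Definition conjugate (rho sigma : goodHom) : bool :=
  `[< exists A : SL3 C, forall x, ghom sigma x = (A * ghom rho x * A^-1)%g >].

Lemma conjugate_refl : reflexive conjugate.
Proof. by move=> rho; apply/asboolP; exists 1%g => x; rewrite mul1g invg1 mulg1. Qed.

Lemma conjugate_sym : symmetric conjugate.
Proof.
suff H rho sigma : conjugate rho sigma -> conjugate sigma rho.
  by move=> rho sigma; apply/idP/idP; apply: H.
move=> /asboolP[A hA]; apply/asboolP; exists A^-1%g => x.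
by rewrite hA !mulgA invgK mulVg mul1g mulgVK.
Qed.

Lemma conjugate_trans : transitive conjugate.
Proof.
move=> sigma rho eta /asboolP[A hA] /asboolP[B hB]; apply/asboolP.
by exists (B * A)%g => x; rewrite hB hA invgM !mulgA.
Qed.

Canonical conjugate_equiv :=
  EquivRel conjugate conjugate_refl conjugate_sym conjugate_trans.

Definition Rstar := quotient_topology {eq_quot conjugate}%qT.
HB.instance Definition _ := Topological.on Rstar.
HB.instance Definition _ := Quotient.on Rstar.

Definition cls (rho : goodHom) : Rstar := (\pi_Rstar rho)%qT.

Definition tau (x : F) (r : Rstar) : C := \tr (slmx (ghom (repr r) x)).

Lemma tau_cls x rho : tau x (cls rho) = \tr (slmx (ghom rho x)).
Proof.
have: cls rho = cls (repr (cls rho)) by rewrite /cls reprK.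
move=> /eqmodP/asboolP[A hA].
by rewrite /tau hA /= -mulmxA mxtrace_mulC -mulmxA mulVmx ?slmx_unit ?mulmx1.
Qed.

(* Local restrictions of holomorphic functions of the matrix entries. *)
Definition holomorphic_hom_at (E : normedModType C) (f : goodHom -> E)
    (rho : goodHom) : Prop :=
  exists2 f' : 'M[C]_(k, 3 * 3) -> E,
    \forall a \near coords (ghom rho), differentiable f' a &
    \forall sigma \near rho, f sigma = f' (coords (ghom sigma)).

(* The complex structure of Rstar is the one for which the projection cls is a
   holomorphic submersion, so a function on an open set W is holomorphic iff
   its pullback by cls is. *)
Definition holomorphic_on (E : normedModType C) (W : set Rstar)
    (f : Rstar -> E) : Prop :=
  forall rho, W (cls rho) -> holomorphic_hom_at (f \o cls) rho.

(* Holomorphic maps from an open set V to Rstar: continuous maps pulling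
   holomorphic functions back to holomorphic functions. *)
Definition holomorphic_into (n : nat) (V : set 'rV[C]_n)
    (g : 'rV[C]_n -> Rstar) : Prop :=
  {in V, continuous g} /\
  forall (W : set Rstar) (f : Rstar -> C), open W -> holomorphic_on W f ->
    forall v, V v -> W (g v) -> differentiable (f \o g) v.

Definition local_parameterization (n : nat) (D : set Rstar)
    (f : Rstar -> 'rV[C]_n) : Prop :=
  [/\ open D, holomorphic_on D f &
    forall r, D r -> exists (U : set Rstar) (V : set 'rV[C]_n)
        (g : 'rV[C]_n -> Rstar),
      [/\ [/\ open U, U r, U `<=` D & open V],
          [/\ set_fun U V f, set_fun V U g,
              {in U, cancel f g} & {in V, cancel g f}] &
          holomorphic_into V g]].

(* gen i is the generator of index i, numbered from 1. *)
Definition gen (i : nat) : F := nth 1%g gam i.-1.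
Local Notation "''g_' i" := (gen i) (at level 0, i at level 0, format "''g_' i").

Definition trace_words : seq F := (
  flatten [seq [:: 'g_i; 'g_i^-1] | i <- index_iota 1 k.+1]
  ++ flatten [seq [:: 'g_1 * 'g_i; 'g_1^-1 * 'g_i^-1] | i <- index_iota 2 k.+1]
  ++ flatten [seq [:: 'g_2 * 'g_i; 'g_2^-1 * 'g_i^-1] | i <- index_iota 3 k.+1]
  ++ flatten [seq [:: 'g_1 * 'g_i^-1; 'g_1^-1 * 'g_i] | i <- index_iota 2 k.+1]
  )%g.

Lemma size_trace_words : (3 <= k)%N -> size trace_words = (8 * k - 8)%N.
Proof.
have H (f1 f2 : nat -> F) s :
    size (flatten [seq [:: f1 i; f2 i] | i <- s]) = (2 * size s)%N.
  by elim: s => //= i s ->; rewrite mulnS.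
by move=> k3; rewrite !size_cat !H !size_iota; lia.
Qed.

Definition trace_map (r : Rstar) : 'rV[C]_(8 * k - 8) :=
  \row_j tau (nth 1%g trace_words j) r.

Definition Delta1_2 (i : nat) (r : Rstar) : C :=
  (tau ('g_1 * 'g_2 * 'g_i)%g r - tau ('g_1 * 'g_i * 'g_2)%g r)
  * (tau ('g_1^-1 * 'g_2^-1 * 'g_i^-1)%g r
     - tau ('g_1^-1 * 'g_i^-1 * 'g_2^-1)%g r)
  - (tau ('g_1 * 'g_2^-1 * 'g_i^-1)%g r - tau ('g_1 * 'g_i^-1 * 'g_2^-1)%g r)
  * (tau ('g_1^-1 * 'g_2 * 'g_i)%g r - tau ('g_1^-1 * 'g_i * 'g_2)%g r).

Definition crit : set Rstar :=
  \bigcup_(i in [set i | (2 <= i <= k)%N])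
    [set r | tau ('g_1 * 'g_i * 'g_1^-1 * 'g_i^-1)%g r
             = tau ('g_i * 'g_1 * 'g_i^-1 * 'g_1^-1)%g r]
  `|` \bigcup_(i in [set i | (3 <= i <= k)%N]) [set r | Delta1_2 i r = 0].

End CharacterManifold.

(* Main.v *)
(* Write A, B, X for the images of g_1, g_2, g_i.  Traces are conjugation
   invariant, so the claim is that, at a noncritical point, the differentials of
   the 8 k - 8 traces and of the k determinants are linearly independent: their
   common kernel then has dimension 8, hence is the tangent space of the orbit,
   and the inverse function theorem applies on a slice transverse to the orbit.

   The differentials along the i-th factor amount, for i >= 3, to the nine
   matrices 1, X, XA, XA^-1, XB, X^-1, A^-1 X^-1, AX^-1, B^-1 X^-1.  Pairing a
   linear relation between them with commutators of powers of A and X for the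
   trace form, all but a few terms cancel, and the surviving coefficients are
   tr [A, X] - tr [X, A] and the entries of a 2 x 2 matrix of determinant, up to
   sign, Delta^1_2i.  Independence is thus obtained one factor at a time, for
   i >= 3, then i = 2, then i = 1.

   A commutator M in SL_3 with tr M <> tr M^-1 does not have the eigenvalue 1, so
   noncritical points are irreducible, hence good: no goodness condition has to
   be checked when moving along the slice.  Every point near x_0 is conjugate to
   one of the slice, by the inverse function theorem again. *)
Require Import Defs.
From HB Require Import structures.
From mathcomp Require Import all_boot all_order all_algebra.
From mathcomp Require Import complex zify ring.
From mathcomp Require Import all_classical all_reals all_analysis.
Set Implicit Arguments.
Unset Strict Implicit.
Unset Printing Implicit Defensive.
Import Order.TTheory GRing.Theory Num.Theory.
Import numFieldNormedType.Exports.
Local Open Scope classical_set_scope.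
Local Open Scope ring_scope.

(** * Traces of 3 x 3 matrices *)

(** The analysis takes place in the linear space of all k-tuples of 3 x 3 matrices: inverses are
    replaced by the polynomial [adj3], and the k determinants become further coordinates, to be held
    at 1. The differentials are then explicit and their independence is pure algebra. Of the inverse
    function theorem only one form is used: a self-map whose strict differential at a point is the
    identity is invertible near that point. A linear right inverse [r] of the differential of
    determinants and traces, and a map [Q] which writes the kernel of this differential as tangent
    vectors to the orbit, bring both applications to this form: [straighten] turns the traces into
    linear coordinates, and [spread] moves the slice along the orbits. *)

Section Matrix3.
Variable C : fieldType.
Implicit Types A B X Y : 'M[C]_3.

(** The second coefficient of the characteristic polynomial, equal to the trace of the inverse when
    the determinant is 1. *)
Definition tr2 X : C := X 0 0 * X 1 1 - X 0 1 * X 1 0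
  + (X 0 0 * X 2 2 - X 0 2 * X 2 0) + (X 1 1 * X 2 2 - X 1 2 * X 2 1).

(* The adjugate, in a form which is visibly polynomial. *)
Definition adj3 X : 'M[C]_3 := X *m X - \tr X *: X + (tr2 X)%:M.

Lemma ord3_ind (P : 'I_3 -> Prop) : P 0 -> P 1 -> P 2 -> forall i, P i.
Proof.
move=> P0 P1 P2 [[|[|[|//]]] li].
- by rewrite (_ : Ordinal li = 0) //; apply/val_inj.
- by rewrite (_ : Ordinal li = 1) //; apply/val_inj.
- by rewrite (_ : Ordinal li = 2) //; apply/val_inj.
Qed.

Lemma sum3 (f : 'I_3 -> C) : \sum_i f i = f 0 + f 1 + f 2.
Proof.
rewrite !big_ord_recl big_ord0 addr0 addrA.
by congr (f _ + f _ + f _); apply/val_inj.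
Qed.

Lemma mulmx3E A B i j : (A *m B) i j = A i 0 * B 0 j + A i 1 * B 1 j + A i 2 * B 2 j.
Proof. by rewrite mxE sum3. Qed.

Lemma tr3E A : \tr A = A 0 0 + A 1 1 + A 2 2.
Proof. by rewrite /mxtrace sum3. Qed.

Lemma det3E A : \det A =
    A 0 0 * (A 1 1 * A 2 2 - A 1 2 * A 2 1)
  - A 0 1 * (A 1 0 * A 2 2 - A 1 2 * A 2 0)
  + A 0 2 * (A 1 0 * A 2 1 - A 1 1 * A 2 0).
Proof.
rewrite (expand_det_row _ 0) sum3 /cofactor.
have det2 (M : 'M[C]_2) : \det M = M 0 0 * M 1 1 - M 0 1 * M 1 0.
  rewrite (expand_det_row _ 0) !big_ord_recl big_ord0 /cofactor !det_mx11 !mxE /=.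
  rewrite !expr0 !expr1 !mul1r !mulN1r addr0 mulrN.
  by congr (_ * M _ _ - M _ _ * M _ _); apply/val_inj.
rewrite !det2 !mxE /= !expr0 !expr1 expr2 !mulN1r mul1r opprK mul1r mulrN.
congr (_ * _ - _ * _ + _ * _).
- by congr (A _ _ * A _ _ - A _ _ * A _ _); apply/val_inj.
- by congr (A _ _ * A _ _ - A _ _ * A _ _); apply/val_inj.
- by congr (A _ _ * A _ _ - A _ _ * A _ _); apply/val_inj.
Qed.

Lemma mulmx_adj3 X : X *m adj3 X = (\det X)%:M.
Proof.
apply/matrixP => i j; rewrite mulmx3E !mxE !sum3 tr3E det3E /tr2.
by elim/ord3_ind: i; elim/ord3_ind: j; rewrite /= ?mulr1n ?mulr0n; ring.
Qed.
End Matrix3.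

Lemma tr_mulC (C : fieldType) (X Y : 'M[C]_3) : \tr (X * Y) = \tr (Y * X).
Proof. exact: mxtrace_mulC. Qed.

(** Equates the traces of two words that are cyclic rotations of each other; each round moves the
    last letter to the front. *)
Ltac cyc := rewrite ?mulrA; do 7?[reflexivity | rewrite [LHS]tr_mulC ?mulrA].

(** * Pairings with commutators for the trace form *)

Section TraceRelations.
Variable C : fieldType.
Implicit Types A B K U V X Y Z : 'M[C]_3.

Lemma trB X Y : \tr (X - Y) = \tr X - \tr Y.
Proof. exact: raddfB. Qed.

Lemma trN X : \tr (- X) = - \tr X.
Proof. exact: raddfN. Qed.

(** By cyclicity, [\tr (X [Y, Z])] is [\tr ([X, Y] Z)]: a commutator is orthogonal to whatever
    commutes with one of its two entries. *)
Lemma tr_comm_l X Y Z : X * Y = Y * X -> \tr (X * (Y * Z - Z * Y)) = 0.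
Proof.
by move=> XY; rewrite mulrBr trB mulrA XY (mulrA X) [X in _ - X]tr_mulC
  mulrA subrr.
Qed.

Lemma tr_comm_r X Y Z : X * Z = Z * X -> \tr (X * (Y * Z - Z * Y)) = 0.
Proof. by move=> XZ; rewrite -opprB mulrN raddfN /= tr_comm_l ?oppr0. Qed.

Lemma tr_comm_sandwich Y Z : \tr (Z * Y * Z * (Y * Z - Z * Y)) = 0.
Proof.
by rewrite mulrBr trB !mulrA; apply/eqP; rewrite subr_eq0; apply/eqP; cyc.
Qed.

Lemma tr_sandwich_commV X X' Y Z : X * X' = 1 ->
  \tr (X * Z * X * (Y * X' - X' * Y)) = \tr (Y * Z * X) - \tr (Y * X * Z).
Proof.
move=> XX; have XX' : X' * X = 1 by apply: mulmx1C.
rewrite mulrBr trB !mulrA -(mulrA (X * Z) X X') XX mulr1; congr (_ - _).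
  by rewrite [LHS]tr_mulC !mulrA XX' mul1r; cyc.
by cyc.
Qed.

(** The trace of the commutator of [A] and [B] minus that of its inverse, when [A'] and [B'] are the
    inverses. As these are separate arguments, inverting a matrix is a swap of arguments, and only
    changes the sign. *)
Definition trcomm A A' B B' := \tr (A * B * A' * B') - \tr (B * A * B' * A').

Section Pair.
Variables (A A' B B' : 'M[C]_3).
Hypotheses (AA : A * A' = 1) (BB : B * B' = 1).
Let AA' : A' * A = 1. Proof. exact: mulmx1C. Qed.
Let BB' : B' * B = 1. Proof. exact: mulmx1C. Qed.

Lemma trcomm_swap : trcomm B B' A A' = - trcomm A A' B B'.
Proof. by rewrite /trcomm opprB. Qed.

Lemma trcommV : trcomm A' A B B' = - trcomm A A' B B'.
Proof.
rewrite /trcomm opprB; congr (_ - _).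
 by cyc.
  by cyc.
Qed.

(** The trace is that of [B * B] against [A * B * A' - A' * B * A]. Cayley-Hamilton, in the form
    [CH] valid for determinant 1, replaces [B * B] by [B'] up to terms in [B] and 1, which pair to
    zero. *)
Lemma tr_sandwich_comm t s : B * B = t *: B - s *: 1 + B' ->
  \tr (B * A * B * (A' * B - B * A')) = trcomm A A' B B'.
Proof.
move=> CH; transitivity (\tr (B * B * (A * B * A' - A' * B * A))).
  rewrite !mulrBr !trB !mulrA; congr (_ - _).
 by cyc.
  by cyc.
rewrite CH mulrDl mulrBl -!scalerAl mul1r mxtraceD trB !mxtraceZ.
rewrite !mulrBr !trB !mulrA.
rewrite (_ : \tr (B * A * B * A') - \tr (B * A' * B * A) = 0); last first.
  by rewrite -(mulrA _ B A) [X in _ - X]tr_mulC !mulrA subrr.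
rewrite (_ : \tr (A * B * A') - \tr (A' * B * A) = 0); last first.
  by rewrite [X in _ - X]tr_mulC !mulrA AA mul1r tr_mulC mulrA AA' mul1r subrr.
rewrite !mulr0 subr0 add0r /trcomm; congr (_ - _).
 by cyc.
  by cyc.
Qed.

(* The matrix [A * B * A' - A' * B * A] is orthogonal to [1], [A], [A'] and [B]
   for the trace form, and pairs with [B'] to [trcomm A A' B B']. *)
Lemma indep5_aux c0 c1 c2 c3 c4 : trcomm A A' B B' != 0 ->
  c0 *: 1 + c1 *: A + c2 *: A' + c3 *: B + c4 *: B' = 0 -> c4 = 0.
Proof.
move=> d0 /(congr1 (fun M => \tr (M * (A * B * A' - A' * B * A)))).
rewrite mul0r mxtrace0 !mulrDl -!scalerAl !mxtraceD !mxtraceZ.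
rewrite mul1r !mulrBr !trB !mulrA AA AA' !mul1r.
rewrite (_ : \tr (A * B * A') - \tr (A' * B * A) = 0); last first.
  by rewrite [X in _ - X]tr_mulC !mulrA AA mul1r tr_mulC mulrA AA' mul1r subrr.
rewrite (_ : \tr (A * A * B * A') - \tr (B * A) = 0); last first.
  by rewrite tr_mulC !mulrA AA' mul1r tr_mulC subrr.
rewrite (_ : \tr (B * A') - \tr (A' * A' * B * A) = 0); last first.
  by rewrite [X in _ - X]tr_mulC !mulrA AA mul1r tr_mulC subrr.
rewrite (_ : \tr (B * A * B * A') - \tr (B * A' * B * A) = 0); last first.
  by rewrite -(mulrA _ B A) [X in _ - X]tr_mulC !mulrA subrr.
rewrite !mulr0 !add0r (_ : _ - _ = trcomm A A' B B'); last first.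
  rewrite /trcomm; congr (_ - _).
 by cyc.
  by cyc.
by move=> /eqP; rewrite mulf_eq0 (negPf d0) orbF => /eqP.
Qed.
End Pair.

Section Indep.
Variables (A A' B B' : 'M[C]_3).
Hypotheses (AA : A * A' = 1) (BB : B * B' = 1) (d0 : trcomm A A' B B' != 0).
Let AA' : A' * A = 1. Proof. exact: mulmx1C. Qed.
Let BB' : B' * B = 1. Proof. exact: mulmx1C. Qed.

(** [indep5_aux] isolates only the last coefficient. Exchanging the two pairs, or a matrix with its
    inverse, preserves [trcomm] up to sign, so [B], [A'] and [A] can be put last in turn. *)
Lemma indep5 c0 c1 c2 c3 c4 :
  c0 *: 1 + c1 *: A + c2 *: A' + c3 *: B + c4 *: B' = 0 ->
  [/\ c0 = 0, c1 = 0, c2 = 0, c3 = 0 & c4 = 0].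
Proof.
move=> E; have c40 := indep5_aux AA d0 E.
have dA : trcomm B B' A A' != 0 by rewrite trcomm_swap oppr_eq0.
have dA' : trcomm B' B A A' != 0 by rewrite trcommV oppr_eq0.
have dB' : trcomm A A' B' B != 0 by rewrite trcomm_swap oppr_eq0.
have dBA : trcomm B B' A' A != 0.
  by rewrite trcomm_swap trcommV opprK.
have c30 : c3 = 0.
  apply: (@indep5_aux A A' B' B AA c0 c1 c2 c4) dB' _.
  by rewrite -[RHS]E; apply/matrixP => i j; rewrite !mxE; ring.
have c20 : c2 = 0.
  apply: (@indep5_aux B B' A A' BB c0 c3 c4 c1) dA _.
  by rewrite -[RHS]E; apply/matrixP => i j; rewrite !mxE; ring.
have c10 : c1 = 0.
  apply: (@indep5_aux B B' A' A BB c0 c3 c4 c2) dBA _.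
  by rewrite -[RHS]E c30 c40 c20 !scale0r !addr0.
split=> //; move/(congr1 (fun M : 'M[C]_3 => M 0 0)): E.
by rewrite c10 c20 c30 c40 !scale0r !addr0 !mxE mulr1.
Qed.

(* For the trace form, [A' * B - B * A'] is orthogonal to all terms but
   [B * A * B], and [A * B - B * A] to all terms but [B * A' * B]. *)
Lemma indep7 t s c0 c1 c2 c3 c4 c5 c6 : B * B = t *: B - s *: 1 + B' ->
  c0 *: 1 + c1 *: A + c2 *: A' + c3 *: B + c4 *: B' + c5 *: (B * A * B)
    + c6 *: (B * A' * B) = 0 ->
  [/\ [/\ c0 = 0, c1 = 0, c2 = 0, c3 = 0 & c4 = 0], c5 = 0 & c6 = 0].
Proof.
move=> CH E.
have c50 : c5 = 0.
  move/(congr1 (fun M => \tr (M * (A' * B - B * A')))): E.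
  rewrite mul0r mxtrace0 !mulrDl -!scalerAl !mxtraceD !mxtraceZ.
  rewrite (tr_sandwich_comm AA CH) tr_comm_sandwich.
  rewrite (@tr_comm_l 1) ?mul1r ?mulr1// (@tr_comm_l A) ?AA ?AA'//.
  rewrite (@tr_comm_l A')// (@tr_comm_r B)// (@tr_comm_r B') ?BB ?BB'//.
  by rewrite !mulr0 !add0r addr0 => /eqP; rewrite mulf_eq0 (negPf d0) orbF => /eqP.
have c60 : c6 = 0.
  move/(congr1 (fun M => \tr (M * (A * B - B * A)))): E.
  rewrite mul0r mxtrace0 !mulrDl -!scalerAl !mxtraceD !mxtraceZ.
  rewrite (tr_sandwich_comm AA' CH) tr_comm_sandwich trcommV.
  rewrite (@tr_comm_l 1) ?mul1r ?mulr1// (@tr_comm_l A)//.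
  rewrite (@tr_comm_l A') ?AA ?AA'// (@tr_comm_r B)// (@tr_comm_r B') ?BB ?BB'//.
  rewrite !mulr0 !add0r => /eqP.
  by rewrite mulf_eq0 oppr_eq0 (negPf d0) orbF => /eqP.
by split=> //; apply: indep5; rewrite -[RHS]E c50 c60 !scale0r !addr0.
Qed.
End Indep.
End TraceRelations.

Section Indep9.
Variable C : fieldType.
Implicit Types A B K U V X Y Z : 'M[C]_3.

Definition trDelta A A' B B' X X' : C :=
  (\tr (A * B * X) - \tr (A * X * B)) * (\tr (A' * B' * X') - \tr (A' * X' * B'))
  - (\tr (A * B' * X') - \tr (A * X' * B')) * (\tr (A' * B * X) - \tr (A' * X * B)).

(* Multiplied by [X] on the right, the relation is one between the terms of
   [indep7] and [X * B * X], [B']; pairing with [A * X' - X' * A] and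
   [A' * X' - X' * A'] leaves a 2 x 2 system in [n3], [m3] whose determinant is
   [trDelta] up to sign. *)
Lemma indep9 A A' B B' X X' t s c n0 n1 n2 n3 m0 m1 m2 m3 :
    A * A' = 1 -> X * X' = 1 -> X * X = t *: X - s *: 1 + X' ->
    trcomm A A' X X' != 0 -> (n3 = 0 /\ m3 = 0) \/ trDelta A A' B B' X X' != 0 ->
    c *: 1 + X * (n0 *: 1 + n1 *: A + n2 *: A' + n3 *: B)
      - (m0 *: 1 + m1 *: A' + m2 *: A + m3 *: B') * X' = 0 ->
  c = 0 /\ [/\ n0 = 0, n1 = 0, n2 = 0 & n3 = 0]
        /\ [/\ m0 = 0, m1 = 0, m2 = 0 & m3 = 0].
Proof.
move=> AA XX CH d0 Hnm E.
have AA' : A' * A = 1 by apply: mulmx1C.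
have XX' : X' * X = 1 by apply: mulmx1C.
have {}E : (- n0 * s - m0) *: 1 + (- m2) *: A + (- m1) *: A' + (c + n0 * t) *: X
    + n0 *: X' + n1 *: (X * A * X) + n2 *: (X * A' * X)
    + (n3 *: (X * B * X) - m3 *: B') = 0.
  move/(congr1 (fun M => M * X)): E; rewrite mul0r => <-.
  rewrite mulrBl -(mulrA _ X' X) XX' mulr1 !mulrDl !mulrDr !mulrDl.
  rewrite -!scalerAl -!scalerAr -!scalerAl !mul1r !mulr1 CH ?mulrA.
  by apply/matrixP => i j; rewrite !mxE; ring.
have [n30 m30] : n3 = 0 /\ m3 = 0.
  have H Y : Y * A = A * Y -> Y * A' = A' * Y ->
      n3 * (\tr (Y * B * X) - \tr (Y * X * B))
      + m3 * (\tr (Y * B' * X') - \tr (Y * X' * B')) = 0.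
    move=> YA YA'; move/(congr1 (fun M => \tr (M * (Y * X' - X' * Y)))): E.
    rewrite mul0r mxtrace0 !mulrDl !mulNr -!scalerAl !mxtraceD trN !mxtraceZ.
    rewrite !(tr_sandwich_commV _ _ XX).
    rewrite (@tr_comm_l C 1) ?mul1r ?mulr1//.
    rewrite (@tr_comm_l C A)// (@tr_comm_l C A')// (@tr_comm_r C X) ?XX ?XX'//.
    rewrite (@tr_comm_r C X')// (_ : \tr (Y * A * X) = \tr (Y * X * A)); last first.
      by rewrite YA; cyc.
    rewrite (_ : \tr (Y * A' * X) = \tr (Y * X * A')); last by rewrite YA'; cyc.
    rewrite !subrr !mulr0 !add0r => <-; congr (_ + _).
    rewrite -mulrN [B' * _]mulrBr trB opprB !mulrA; congr (_ * (_ - _)).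
      by rewrite [RHS]tr_mulC !mulrA; cyc.
    by cyc.
  (* The first alternative of [Hnm] serves the factor of index 2, which has no terms in a further
     matrix [B]. In the second, Cramer's rule applies to the equations given by [H] at [A] and at
     [A']. *)
  case: Hnm => // D0; have := H A (erefl _); rewrite AA AA' => /(_ erefl) HA.
  have := H A'; rewrite AA AA' => /(_ erefl erefl) HA'.
  have nD : n3 * trDelta A A' B B' X X' = 0.
    rewrite /trDelta; move: HA HA'; set a := _ - _; set b := _ - _.
    set a' := _ - _; set b' := _ - _ => HA HA'.
    transitivity (b' * (n3 * a + m3 * b) - b * (n3 * a' + m3 * b')); first by ring.
    by rewrite HA HA' !mulr0 subrr.
  have mD : m3 * trDelta A A' B B' X X' = 0.
    rewrite /trDelta; move: HA HA'; set a := _ - _; set b := _ - _.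
    set a' := _ - _; set b' := _ - _ => HA HA'.
    transitivity (a * (n3 * a' + m3 * b') - a' * (n3 * a + m3 * b)); first by ring.
    by rewrite HA HA' !mulr0 subrr.
  split; [move: nD|move: mD] => /eqP; rewrite mulf_eq0 (negPf D0) orbF => /eqP//.
move: E; rewrite n30 m30 !scale0r subrr addr0 => /(indep7 AA XX d0 CH).
move=> [[e0 e1 e2 e3 e4] e5 e6]; rewrite e4 in e0 e3.
move/eqP: e1; rewrite oppr_eq0 => /eqP e1; move/eqP: e2; rewrite oppr_eq0 => /eqP e2.
move: e0 e3; rewrite oppr0 !mul0r add0r addr0 => /eqP; rewrite oppr_eq0 => /eqP e0 e3.
by split=> //; split; split.
Qed.
End Indep9.

(** * The adjugate and its differential; irreducibility *)

Section Adjugate.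
Variable C : fieldType.
Implicit Types A B H K U V X Y Z : 'M[C]_3.

Lemma adj3_mulmx X : adj3 X *m X = (\det X)%:M.
Proof.
rewrite -mulmx_adj3 /adj3 mulmxDl mulmxDr mulmxBl mulmxBr mulmxA.
by rewrite -scalemxAl -scalemxAr scalar_mxC.
Qed.

Lemma adj3_sl X : \det X = 1 -> X * adj3 X = 1.
Proof. by move=> dX; rewrite -[LHS]/(X *m adj3 X) mulmx_adj3 dX. Qed.

Lemma invmx_adj3 X : \det X = 1 -> invmx X = adj3 X.
Proof.
move=> dX; have uX : X \in unitmx by rewrite unitmxE dX unitr1.
by rewrite -[RHS]mul1mx -(mulVmx uX) -mulmxA mulmx_adj3 dX mulmx1.
Qed.

Lemma sqr_adj3 X : X * X = \tr X *: X - tr2 X *: 1 + adj3 X.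
Proof.
rewrite /adj3 -[X *m X]/(X * X); set Y := X * X.
by apply/matrixP => i j; rewrite !mxE -[_ *+ (i == j)]mulr_natr; ring.
Qed.

Definition dadj3 X H : 'M[C]_3 :=
  H *m X + X *m H - \tr H *: X - \tr X *: H + (\tr X * \tr H - \tr (X *m H))%:M.

(** The identity [X *m adj3 X = (\det X)%:M] differentiated in the direction [H]; the right-hand
    side is Jacobi's formula for the differential of the determinant. *)
Lemma mulmx_dadj3 X H : X *m dadj3 X H + H *m adj3 X = (\tr (adj3 X *m H))%:M.
Proof.
apply/matrixP => i j; rewrite /dadj3 /adj3 !(tr3E, mulmx3E, mxE, sum3) /tr2.
by elim/ord3_ind: i; elim/ord3_ind: j; rewrite /= ?mulr1n ?mulr0n; ring.
Qed.

(** The usual differential of the inverse, plus a multiple of [adj3 X] that accounts for directions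
    [H] not tangent to SL_3. *)
Lemma dadj3_sl X H : \det X = 1 ->
  dadj3 X H = \tr (adj3 X * H) *: adj3 X - adj3 X * H * adj3 X.
Proof.
move=> dX; have XX := adj3_sl dX; have XX' := mulmx1C XX.
have /(congr1 (fun M => adj3 X * M)) := mulmx_dadj3 X H.
rewrite mulrDr !mulrA; rewrite [adj3 X * X]XX' mul1r => E.
rewrite -[LHS](addrK (adj3 X * H * adj3 X)) E; congr (_ - _).
by rewrite -scalemx1 -scalerAr mulr1.
Qed.

(** Infinitesimal form of the compatibility of the adjugate with conjugation. *)
Lemma dadj3_comm X H : dadj3 X (H *m X - X *m H) = H *m adj3 X - adj3 X *m H.
Proof.
apply/matrixP => i j; rewrite /dadj3 /adj3 !(tr3E, mulmx3E, mxE, sum3) /tr2.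
by elim/ord3_ind: i; elim/ord3_ind: j; rewrite /= ?mulr1n ?mulr0n; ring.
Qed.

Lemma tr_adj3 X : \tr (adj3 X) = tr2 X.
Proof. by rewrite /adj3 !(tr3E, mulmx3E, mxE) /tr2 /= ?mulr1n; ring. Qed.

Lemma det_1B X : \det (1 - X) = 1 - \tr X + tr2 X - \det X.
Proof. by rewrite !det3E !mxE tr3E /tr2 /= ?mulr1n ?mulr0n; ring. Qed.

(* The commutator [M] fixes [u], and [\det (1 - M) = \tr M^-1 - \tr M] on SL3. *)
Lemma trcomm_fixed A A' B B' (u : 'rV[C]_3) a b : A * A' = 1 -> B * B' = 1 ->
  u != 0 -> u *m A = a *: u -> u *m B = b *: u -> trcomm A A' B B' = 0.
Proof.
move=> AA BB u0 uA uB; have AA' : A' * A = 1 := mulmx1C AA; have BB' : B' * B = 1 := mulmx1C BB.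
have inv (D D' : 'M[C]_3) e : D * D' = 1 -> u *m D = e *: u -> u *m D' = e^-1 *: u.
  move=> DD uD; have e0 : e != 0.
    apply: contra_neq u0 => e0; rewrite -[u]mulmx1 -[1%:M]/(1 : 'M[C]_3) -DD mulmxA uD.
    by rewrite e0 scale0r mul0mx.
  by rewrite -[u in LHS](scalerK e0) -uD -scalemxAl -mulmxA [D *m D']DD mulmx1.
have uM : u *m (A * B * A' * B') = u.
  rewrite !mulmxA uA -scalemxAl uB scalerA -scalemxAl (inv _ _ _ AA uA) scalerA.
  rewrite -scalemxAl (inv _ _ _ BB uB) scalerA.
  have [a0|a0] := eqVneq a 0.
    move: u0; rewrite -[u]mulmx1 -[1%:M]/(1 : 'M[C]_3) -AA mulmxA uA a0.
    by rewrite scale0r mul0mx eqxx.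
  have [b0|b0] := eqVneq b 0.
    move: u0; rewrite -[u]mulmx1 -[1%:M]/(1 : 'M[C]_3) -BB mulmxA uB b0.
    by rewrite scale0r mul0mx eqxx.
  by rewrite (_ : _ * _ = 1) ?scale1r//; field; rewrite a0 b0.
have dM : \det (A * B * A' * B') = 1.
  have detV (D D' : 'M[C]_3) : D * D' = 1 -> \det D * \det D' = 1.
    by move=> DD; rewrite -det_mulmx [D *m D']DD det1.
  rewrite !det_mulmx -[RHS](mulr1 1) -[X in _ = X * _](detV _ _ AA).
  by rewrite -(detV _ _ BB); ring.
have M0 : \det (1 - A * B * A' * B') = 0.
  apply/eqP/det0P; exists u => //.
  by rewrite mulmxBr uM (mulmx1 u : u *m 1 = u) subrr.
have MM : adj3 (A * B * A' * B') = B * A * B' * A'.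
  have MN : (A * B * A' * B') * (B * A * B' * A') = 1.
    by rewrite !mulrA -(mulrA _ B' B) BB' mulr1 -(mulrA _ A' A) AA' mulr1
      -(mulrA _ B B') BB mulr1.
  by rewrite -[LHS]mulr1 -MN mulrA (mulmx1C (adj3_sl dM) : adj3 _ * _ = 1) mul1r.
rewrite /trcomm -MM tr_adj3; move: M0; rewrite det_1B dM.
set x := \tr _; set y := tr2 _ => E.
by transitivity (- (1 - x + y - 1)); [ring | rewrite E oppr0].
Qed.

Lemma trcomm_tr A A' B B' : trcomm A^T A'^T B^T B'^T = - trcomm A A' B B'.
Proof.
rewrite /trcomm opprB -[X in X - _]mxtrace_tr -[X in _ - X]mxtrace_tr.
by congr (_ - _); rewrite -![_ * _]/(_ *m _) !trmx_mul !trmxK; cyc.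
Qed.

(** An invariant line is spanned by a common eigenvector, which [trcomm_fixed] excludes. An
    invariant plane gives an invariant line of the transposed matrices, its annihilator, and
    transposition only changes the sign of [trcomm]. *)
Lemma trcomm_irr A A' B B' U : A * A' = 1 -> B * B' = 1 ->
  trcomm A A' B B' != 0 -> stablemx U A -> stablemx U B -> U = 0 \/ row_full U.
Proof.
move=> AA BB d0 UA UB.
have rank1 D D' E E' V : D * D' = 1 -> E * E' = 1 -> trcomm D D' E E' != 0 ->
    stablemx V D -> stablemx V E -> \rank V = 1 -> False.
  move=> DD EE e0 VD VE rV.
  have V0 : V != 0 by rewrite -mxrank_eq0 rV.
  have u0 : nz_row V != 0 by rewrite nz_row_eq0.
  have Vu : (V <= nz_row V)%MS.
    by rewrite -(mxrank_leqif_sup (nz_row_sub V)).2 rV rank_rV u0.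
  have st F : stablemx V F -> exists a, nz_row V *m F = a *: nz_row V.
    move=> VF; apply/sub_rVP; apply: submx_trans (submxMr F (nz_row_sub V)) _.
    exact: submx_trans VF Vu.
  have [a ua] := st _ VD; have [b ub] := st _ VE.
  by move: e0; rewrite (trcomm_fixed DD EE u0 ua ub) eqxx.
have : (\rank U <= 3)%N by exact: rank_leq_row.
case rU: (\rank U) => [|[|[|[|//]]]] _.
- by left; apply/eqP; rewrite -mxrank_eq0 rU.
- by have := rank1 _ _ _ _ _ AA BB d0 UA UB rU.
- exfalso; apply: (rank1 A^T A'^T B^T B'^T (kermx U^T)).
  + by rewrite -[LHS]/(_ *m _) -trmx_mul (mulmx1C AA) trmx1.
  + by rewrite -[LHS]/(_ *m _) -trmx_mul (mulmx1C BB) trmx1.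
  + by rewrite trcomm_tr oppr_eq0.
  + apply/sub_kermxP; case/submxP: UA => D UA.
    by rewrite -mulmxA -trmx_mul UA trmx_mul mulmxA mulmx_ker mul0mx.
  + apply/sub_kermxP; case/submxP: UB => D UB.
    by rewrite -mulmxA -trmx_mul UB trmx_mul mulmxA mulmx_ker mul0mx.
  + by rewrite mxrank_ker mxrank_tr rU.
- by right; rewrite /row_full rU.
Qed.

End Adjugate.

(** Schur's lemma: an eigenspace of [Z] is nonzero and invariant under [A] and [B], hence
    everything. *)
Lemma trcomm_centralizer (C : closedFieldType) (A A' B B' Z : 'M[C]_3) :
  A * A' = 1 -> B * B' = 1 -> trcomm A A' B B' != 0 ->
  Z * A = A * Z -> Z * B = B * Z -> exists c, Z = c%:M.
Proof.
move=> AA BB d0 ZA ZB.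
have [c] : exists c, root (char_poly Z) c.
  by apply/closed_rootP; rewrite size_char_poly.
rewrite -eigenvalue_root_char => /eigenvalueP[v vZ v0]; exists c.
have st D : Z * D = D * Z -> stablemx (kermx (Z - c%:M)) D.
  move=> ZD; apply/sub_kermxP.
  rewrite -mulmxA (_ : D *m (Z - c%:M) = (Z - c%:M) *m D).
    by rewrite mulmxA mulmx_ker mul0mx.
  by rewrite mulmxBr mulmxBl scalar_mxC; congr (_ - _).
have vK : (v <= kermx (Z - c%:M))%MS.
  by apply/sub_kermxP; rewrite mulmxBr vZ mul_mx_scalar subrr.
have [K0|fK] := trcomm_irr AA BB d0 (st _ ZA) (st _ ZB).
  by move: vK; rewrite K0 submx0 (negPf v0).
apply/eqP; rewrite -subr_eq0; apply/eqP.
have /row_fullP[D DK] := fK.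
by rewrite -[LHS]mul1mx -DK -mulmxA mulmx_ker mulmx0.
Qed.

(** * Strict differentiability and the inverse function theorem *)

Lemma cvg_geometric_step (R : realType) (a : nat -> R) c :
  (forall n, `|a n.+1 - a n| <= c * 2^-1 ^+ n) -> cvgn a.
Proof.
move=> ac; have -> : a = (fun n => a 0%N + series (telescope a) n).
  by apply/funext => n; exact: eq_sum_telescope.
apply: is_cvgD; first exact: is_cvg_cst.
apply: (@normed_cvg R R^o); apply: (@series_le_cvg _ _ (geometric c 2^-1)) => //.
- by move=> n; rewrite /=.
- by move=> n; apply: (le_trans _ (ac n)).
- by apply: is_cvg_geometric_series; rewrite ger0_norm ?invr_ge0 ?invf_lt1 ?ltr1n.
Qed.

Section MatrixConvergence.
Variables (R : realType).
Local Notation C := (Cplx R).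

Lemma norm_cplx_le (x : C) : `|x| <= (`|complex.Re x| + `|complex.Im x|)%:C%C.
Proof.
rewrite {1}[x]complexE; apply: le_trans (ler_normD _ _) _.
have nC (r : R) : `|r%:C%C| = `|r|%:C%C :> C.
  by rewrite normc_def /= expr0n/= addr0 sqrtr_sqr.
by rewrite normrM complexiE normCi mul1r rmorphD !nC.
Qed.

Lemma cplx_cvg_geometric (u : nat -> C) (c : C) :
  (forall n, `|u n.+1 - u n| <= c * 2^-1 ^+ n) -> exists l : C, u @ \oo --> l.
Proof.
move=> uc.
(* In the partial order of the complex numbers, the bound at [n = 0] already forces [c] to be
   real. *)
have cR : c \is Num.real.
  by apply: ger0_real; have := uc 0%N; rewrite expr0 mulr1; apply: le_trans.
pose d := complex.Re c.
have ud n : `|u n.+1 - u n| <= (d * 2^-1 ^+ n)%:C%C.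
  by rewrite rmorphM rmorphXn fmorphV rmorph_nat /= RRe_real.
have cvgRe : cvgn (fun n => complex.Re (u n)).
  apply: (@cvg_geometric_step _ _ d) => n; rewrite -lecR.
  apply: le_trans (ud n); apply: le_trans (normc_ge_Re _).
  by rewrite raddfB.
have cvgIm : cvgn (fun n => complex.Im (u n)).
  apply: (@cvg_geometric_step _ _ d) => n; rewrite -lecR.
  apply: le_trans (ud n).
  have -> : complex.Im (u n.+1) - complex.Im (u n) = - complex.Re ('i%C * (u n.+1 - u n)).
    by case: (u n.+1) => a b; case: (u n) => a' b' /=; rewrite mul0r mul1r sub0r opprK.
  rewrite normrN; apply: le_trans (normc_ge_Re _) _.
  by rewrite normrM complexiE normCi mul1r.
exists (Complex (limn (fun n => complex.Re (u n))) (limn (fun n => complex.Im (u n)))).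
apply/cvgrPdist_lt => e e0; have eR : e \is Num.real by exact: gtr0_real.
move: e0; rewrite -(RRe_real eR) ltcR => e0.
near=> n; apply: le_lt_trans (norm_cplx_le _) _; rewrite ltcR.
rewrite (splitr (complex.Re e)) ltrD//.
  rewrite [complex.Re _](_ : _ = limn (fun n => complex.Re (u n)) - complex.Re (u n)).
    by near: n; apply: (cvgrPdist_lt _ _).1 => //; rewrite divr_gt0.
  by case: (u n).
rewrite [complex.Im _](_ : _ = limn (fun n => complex.Im (u n)) - complex.Im (u n)).
  by near: n; apply: (cvgrPdist_lt _ _).1 => //; rewrite divr_gt0.
by case: (u n).
Unshelve. all: by end_near. Qed.

Lemma mx_entry_norm m n (M : 'M[C]_(m, n)) i j : `|M i j| <= `|M|.
Proof.
rewrite [leRHS]/Num.norm /= mx_normE -[leLHS]nngE num_le.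
exact: (le_bigmax _ (fun ij => `|M ij.1 ij.2|%:nng) (i, j)).
Qed.

Lemma mx_cvg_geometric m n (u : nat -> 'M[C]_(m, n)) (c : C) :
  (forall k, `|u k.+1 - u k| <= c * 2^-1 ^+ k) -> exists l : 'M[C]_(m, n), u @ \oo --> l.
Proof.
move=> uc.
have ij_cvg i j : exists l : C, (fun k => u k i j) @ \oo --> l.
  apply: (@cplx_cvg_geometric _ c) => k; apply: le_trans (uc k).
  by rewrite -[X in X - _]/(u k.+1 i j); have := mx_entry_norm (u k.+1 - u k) i j;
    rewrite !mxE.
pose l i j := sval (cid (ij_cvg i j)).
exists (\matrix_(i, j) l i j) => A [P nP PA].
have : \forall k \near \oo, forall i j, P i j (u k i j).
  apply: filter_forall => i; apply: filter_forall => j.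
  have := svalP (cid (ij_cvg i j)); apply.
  by have := nP i j; rewrite mxE.
by apply: filterS => k uk; apply: PA.
Qed.
End MatrixConvergence.

Lemma linear_morphB (K : pzRingType) (V W : lmodType K) (l : V -> W) :
  linear l -> {morph l : x y / x - y}.
Proof. by move=> ll x y; rewrite [x - y]addrC -[- y]scaleN1r ll scaleN1r addrC. Qed.

Lemma linear_morphD (K : pzRingType) (V W : lmodType K) (l : V -> W) :
  linear l -> {morph l : x y / x + y}.
Proof. by move=> ll x y; rewrite -[x]scale1r ll !scale1r. Qed.

Lemma linear_morph0 (K : pzRingType) (V W : lmodType K) (l : V -> W) :
  linear l -> l 0 = 0.
Proof. by move=> ll; rewrite -(subrr 0) linear_morphB// subrr. Qed.

Lemma linear_morphZ (K : pzRingType) (V W : lmodType K) (l : V -> W) c x :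
  linear l -> l (c *: x) = c *: l x.
Proof. by move=> ll; rewrite -[c *: x]addr0 ll linear_morph0// addr0. Qed.

Section StrictDifferential.
Variables (R : realType) (p q : nat).
Local Notation C := (Cplx R).
Local Notation E := 'M[C]_(p, q).

Lemma mx_norm_le m n (M : 'M[C]_(m, n)) (e : C) :
  0 <= e -> (forall i j, `|M i j| <= e) -> `|M| <= e.
Proof.
move=> e0 Me; rewrite [leLHS]/Num.norm /= mx_normE.
have -> : e = (NngNum e0)%:num by [].
rewrite num_le; apply/bigmax_leP; split; first by rewrite -num_le.
by move=> [i j] _; rewrite -num_le /=; exact: Me.
Qed.

Lemma mx_linear_bounded m n (W : normedModType C) (l : 'M[C]_(m, n) -> W) :
  linear l -> exists2 c, 0 <= c & forall x, `|l x| <= c * `|x|.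
Proof.
move=> ll.
exists (\sum_i \sum_j `|l (delta_mx i j)|).
  by apply: sumr_ge0 => i _; apply: sumr_ge0.
move=> x; rewrite {1}[x]matrix_sum_delta.
rewrite (big_morph l (linear_morphD ll) (linear_morph0 ll)).
apply: le_trans (ler_norm_sum _ _ _) _; rewrite mulr_suml; apply: ler_sum => i _.
rewrite (big_morph l (linear_morphD ll) (linear_morph0 ll)); apply: le_trans (ler_norm_sum _ _ _) _.
rewrite mulr_suml; apply: ler_sum => j _.
by rewrite (linear_morphZ _ _ ll) normrZ mulrC ler_wpM2l// mx_entry_norm.
Qed.

(** Strict differentiability: the estimate is uniform in both points. It makes the Lipschitz
    constant of [f - l] small near [a], as the contraction argument of the inverse function theorem
    demands, without any mean value inequality. *)
Definition strict_diff (W : normedModType C) (f : E -> W) (a : E) (l : E -> W) :=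
  linear l /\ forall e, 0 < e -> exists2 N, nbhs a N &
    forall x y, N x -> N y -> `|f x - f y - l (x - y)| <= e * `|x - y|.

Section Calculus.
Variable a : E.

Lemma strict_diff_eq (W : normedModType C) (f g : E -> W) l l' :
  f =1 g -> l =1 l' -> strict_diff f a l -> strict_diff g a l'.
Proof. by move=> /funext-> /funext->. Qed.

(** Allows estimates up to a constant and only for [e <= 1]: they are used at [e / (c + 1 + e)],
    which is at most 1 and stays below [e] after multiplication by [c]. *)
Lemma strict_diff_bigO (W : normedModType C) (f l : E -> W) c : linear l -> 0 <= c ->
  (forall e, 0 < e -> e <= 1 -> exists2 N, nbhs a N &
    forall x y, N x -> N y -> `|f x - f y - l (x - y)| <= c * e * `|x - y|) ->
  strict_diff f a l.
Proof.
move=> ll c0 H; split=> // e e0.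
have d0 : 0 < c + 1 + e by rewrite addr_gt0// ltr_wpDl.
have e'1 : e / (c + 1 + e) <= 1.
  by rewrite ler_pdivrMr// mul1r lerDr ltW// ltr_wpDl.
have [N aN HN] := H (e / (c + 1 + e)) (divr_gt0 e0 d0) e'1.
exists N => // x y Nx Ny; apply: le_trans (HN x y Nx Ny) _.
rewrite ler_wpM2r// mulrCA ger_pMr// ler_pdivrMr// mul1r.
by rewrite -addrA lerDl addr_ge0// ltW.
Qed.

Lemma strict_diff_lipschitz (W : normedModType C) (f l : E -> W) :
  strict_diff f a l -> exists2 c, 0 <= c & exists2 N, nbhs a N &
    forall x y, N x -> N y -> `|f x - f y| <= c * `|x - y|.
Proof.
case=> ll /(_ 1 ltr01) [N aN HN]; have [c c0 lc] := mx_linear_bounded ll.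
exists (1 + c); first by rewrite addr_ge0.
exists N => // x y Nx Ny; rewrite -[f x - f y](subrK (l (x - y))) mulrDl.
by apply: le_trans (ler_normD _ _) _; apply: lerD (lc _); exact: HN.
Qed.

Lemma strict_diff_near (W : normedModType C) (f l : E -> W) e :
  strict_diff f a l -> 0 < e ->
  exists2 N, nbhs a N & forall x, N x -> `|f x - f a| <= e.
Proof.
move=> /strict_diff_lipschitz[c c0 [N aN HN]] e0.
have e'0 : 0 < e / (c + 1) by rewrite divr_gt0// ltr_wpDl.
exists (N `&` ball a (e / (c + 1))); first by apply: filterI => //; exact: nbhsx_ballx.
move=> x [Nx]; rewrite -ball_normE /= => xa.
apply: le_trans (HN _ _ Nx (nbhs_singleton aN)) _.
rewrite distrC; apply: le_trans (ler_wpM2l c0 (ltW xa)) _.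
by rewrite mulrCA ger_pMr// ler_pdivrMr ?ltr_wpDl// mul1r lerDl.
Qed.

Lemma strict_diff_cst (W : normedModType C) (b : W) :
  strict_diff (fun=> b) a (fun=> 0).
Proof.
split; first by move=> c x y; rewrite scaler0 addr0.
move=> e e0; exists setT; first exact: filterT.
by move=> x y _ _; rewrite subrr subr0 normr0 mulr_ge0// ltW.
Qed.

Lemma strict_diff_linear (W : normedModType C) (l : E -> W) :
  linear l -> strict_diff l a l.
Proof.
move=> ll; split=> // e e0; exists setT; first exact: filterT.
by move=> x y _ _; rewrite (linear_morphB ll) subrr normr0 mulr_ge0// ltW.
Qed.

Lemma strict_diffD (W : normedModType C) (f g l k : E -> W) :
  strict_diff f a l -> strict_diff g a k ->
  strict_diff (fun x => f x + g x) a (fun x => l x + k x).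
Proof.
move=> [ll Hf] [lk Hg]; apply: (@strict_diff_bigO _ _ _ (1 + 1)) => //.
  by move=> c x y; rewrite ll lk scalerDr addrACA.
move=> e e0 _; have [N aN HN] := Hf e e0; have [M aM HM] := Hg e e0.
exists (N `&` M); first exact: filterI.
move=> x y [Nx Mx] [Ny My]; rewrite !mulrDl !mul1r.
apply: le_trans (lerD (HN _ _ Nx Ny) (HM _ _ Mx My)).
apply: le_trans (ler_normD _ _); rewrite le_eqVlt; apply/orP; left; apply/eqP.
by congr `|_|; rewrite !opprD !addrA [LHS](ACl (1*3*5*2*4*6)).
Qed.

(* Boundedness of [u] holds by [mx_linear_bounded] when [W] is a matrix space;
   it is asked for here to cover the scalars as well. *)
Lemma strict_diff_post (W W' : normedModType C) (f l : E -> W) (u : W -> W') d :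
  linear u -> 0 <= d -> (forall x, `|u x| <= d * `|x|) ->
  strict_diff f a l -> strict_diff (u \o f) a (u \o l).
Proof.
move=> lu d0 ud [ll Hf]; apply: (@strict_diff_bigO _ _ _ d) => //.
  by move=> c x y; rewrite /= ll lu.
move=> e e0 _; have [N aN HN] := Hf e e0; exists N => // x y Nx Ny /=.
by rewrite -!(linear_morphB lu) -mulrA; apply: le_trans (ud _) _; rewrite ler_wpM2l// HN.
Qed.

Lemma strict_diff_bilinear (W1 W2 W : normedModType C) (f l : E -> W1)
    (g k : E -> W2) (b : W1 -> W2 -> W) d :
  (forall v, linear (b^~ v)) -> (forall v, linear (b v)) ->
  0 <= d -> (forall v w, `|b v w| <= d * `|v| * `|w|) ->
  strict_diff f a l -> strict_diff g a k ->
  strict_diff (fun x => b (f x) (g x)) a (fun x => b (l x) (g a) + b (f a) (k x)).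
Proof.
move=> bl br d0 bd sf sg; have [ll Hf] := sf; have [lk Hg] := sg.
have blB v w z : b (v - w) z = b v z - b w z := linear_morphB (bl z) v w.
have brB v w z : b z (v - w) = b z v - b z w := linear_morphB (br z) v w.
have [cl cl0 Hl] := mx_linear_bounded ll.
have [cg cg0 [M aM HM]] := strict_diff_lipschitz sg.
apply: (@strict_diff_bigO _ _ _ (d * (1 + `|g a|) + d * cl + d * cg + d * `|f a|)).
- by move=> c x y; rewrite ll lk bl br scalerDr addrACA.
- by rewrite !addr_ge0// mulr_ge0// addr_ge0.
move=> e e0 e1; have [N1 aN1 HN1] := Hf e e0; have [N2 aN2 HN2] := Hg e e0.
have [N3 aN3 HN3] := strict_diff_near sf e0.
have [N4 aN4 HN4] := strict_diff_near sg e0.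
exists (N1 `&` N2 `&` N3 `&` N4 `&` M); first by do !apply: filterI.
move=> x y [[[[x1 x2] x3] x4] xM] [[[[y1 y2] y3] y4] yM].
set h := x - y.
(* The error is a sum of four terms, each with one small factor, bounded by the four summands of the
   constant above; [e <= 1] gives [|g x| <= 1 + |g a|]. *)
have -> : b (f x) (g x) - b (f y) (g y) - (b (l h) (g a) + b (f a) (k h))
    = b (f x - f y - l h) (g x) + b (l h) (g x - g a)
      + b (f y - f a) (g x - g y) + b (f a) (g x - g y - k h).
  rewrite !blB !brB !opprD !opprK !addrA.
  rewrite [RHS](ACl ((1*7*5*12)*(2*6)*(3*4)*(8*10)*(9*11))) /=.
  by rewrite !addNr subrr !addr0.
have eh0 : 0 <= e * `|h| by rewrite mulr_ge0// ltW.
rewrite !mulrDl; apply: le_trans (ler_normD _ _) _; apply: lerD; last first.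
  apply: le_trans (bd _ _) _; rewrite -!mulrA ler_wpM2l// ler_wpM2l//.
  exact: HN2.
apply: le_trans (ler_normD _ _) _; apply: lerD; last first.
  apply: le_trans (bd _ _) _; rewrite -!mulrA ler_wpM2l//.
  by rewrite mulrCA ler_pM// ?HN3// HM.
apply: le_trans (ler_normD _ _) _; apply: lerD; last first.
  apply: le_trans (bd _ _) _; rewrite -!mulrA ler_wpM2l//.
  by rewrite [leRHS]mulrCA [leRHS]mulrC ler_pM// HN4.
apply: le_trans (bd _ _) _; rewrite -!mulrA ler_wpM2l// [leRHS]mulrC.
rewrite ler_pM// ?HN1//.
rewrite -[g x](subrK (g a)); apply: le_trans (ler_normD _ _) _.
by rewrite lerD// (le_trans (HN4 _ x4)).
Qed.
End Calculus.
End StrictDifferential.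

(** * Maps close to the identity and their inverses *)

Section InverseFunction.
Variables (R : realType).
Local Notation C := (Cplx R).

Lemma linear_inj_inverse p q (l : 'M[C]_(p, q) -> 'M[C]_(p, q)) :
  linear l -> (forall x, l x = 0 -> x = 0) ->
  exists2 k, linear k & cancel l k.
Proof.
move=> ll l0.
pose l' : {linear 'M[C]_(p, q) -> 'M[C]_(p, q)} :=
  HB.pack l (GRing.isLinear.Build _ _ _ _ l ll).
have ker0 : lker (linfun l') == 0%VS.
  rewrite -subv0; apply/subvP => x; rewrite memv_ker lfunE => /eqP /l0 ->.
  exact: mem0v.
exists (linfun l')^-1%VF; first exact: linearP.
by move=> x; have := lker0_lfunK ker0 x; rewrite lfunE.
Qed.

Lemma differentiable_approx (V W : normedModType C) (f : V -> W) a
    (l : {linear V -> W}) : continuous l ->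
  (forall e, 0 < e -> exists2 N, nbhs a N &
    forall x, N x -> `|f x - f a - l (x - a)| <= e * `|x - a|) ->
  differentiable f a.
Proof.
move=> cl Hf; have fl : f \o shift a = cst (f a) + l +o_ 0 id.
  apply/eqaddoP => e /Hf[N aN HN]; near=> x.
  have Nx : N (x + a).
    near: x; have := aN; rewrite -[nbhs a N]/(\near a, N a) (near_shift 0) subr0.
    by [].
  by have := HN _ Nx; rewrite addrK /= !fctE opprD addrA.
have dfl : 'd f a = l :> (V -> W) by apply: diff_unique.
by apply/diff_locallyP; rewrite dfl.
Unshelve. all: by end_near. Qed.

Section Differentiable.
Variables (p q : nat).
Local Notation E := 'M[C]_(p, q).

Lemma strict_diff_differentiable (W : normedModType C) (f : E -> W) a l :
  strict_diff f a l -> differentiable f a.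
Proof.
move=> sf; have [ll Hf] := sf; have [c c0 lc] := mx_linear_bounded ll.
pose l' : {linear E -> W} := HB.pack l (GRing.isLinear.Build _ _ _ _ l ll).
have cl : continuous l'.
  move=> x; apply/(@cvgrPdist_le _ _ _ (nbhs x)) => e e0.
  have [N xN HN] := strict_diff_near (strict_diff_linear x ll) e0.
  by apply: filterS xN => y /HN; rewrite distrC.
apply: (differentiable_approx cl) => e /Hf[N aN HN]; exists N => // x Nx.
by apply: HN => //; exact: nbhs_singleton.
Qed.

Definition near_identity (G : E -> E) (a : E) (r : C) :=
  forall x y, `|x - a| < r -> `|y - a| < r ->
    `|G x - G y - (x - y)| <= 2^-1 * `|x - y|.

Lemma strict_diff_near_identity (G : E -> E) a N : strict_diff G a id ->
  nbhs a N -> exists2 r : C, 0 < r & near_identity G a r /\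
    forall x, `|x - a| < r -> N x.
Proof.
move=> [_ /(_ 2^-1)[|M aM HM]]; first by rewrite invr_gt0 ltr0n.
move=> aN.
have aMN : nbhs a (M `&` N) by exact: filterI.
have /nbhs_ballP[r r0 rN] := aMN; exists r => //; split.
  move=> x y xa ya.
  have [] := rN x; first by rewrite -ball_normE /= distrC.
  have [] := rN y; first by rewrite -ball_normE /= distrC.
  by move=> yM _ xM _; exact: HM.
by move=> x xa; have [] := rN x; first by rewrite -ball_normE /= distrC.
Qed.

Lemma near_identity_inj (G : E -> E) a r x y : near_identity G a r ->
  `|x - a| < r -> `|y - a| < r -> `|x - y| <= 2 * `|G x - G y|.
Proof.
move=> nG xa ya; have H := nG x y xa ya.
have : `|x - y| <= `|G x - G y| + 2^-1 * `|x - y|.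
  rewrite -{1}[x - y](subKr (G x - G y)).
  by apply: le_trans (ler_normB _ _) _; rewrite lerD2l.
rewrite -lerBlDr -{1}[`|x - y|]mul1r -mulrBl (_ : 1 - 2^-1 = 2^-1 :> C).
  by rewrite mulrC ler_pdivrMr ?ltr0n// mulrC.
by rewrite {1}[1](splitr 1) mul1r addrK.
Qed.

(** Newton's iteration with the identity in place of the derivative. The steps are at least halved
    each time, so the iterates stay within [2 * |z - G a|] of [a]; the bound [r / 4] makes this less
    than [r / 2], which keeps the limit inside the ball. *)
Lemma near_identity_onto (G : E -> E) a r z : 0 < r -> near_identity G a r ->
  `|z - G a| < r / 4 -> exists2 x, `|x - a| < r & G x = z.
Proof.
move=> r0 nG za.
pose u n := iter n (fun x => x + (z - G x)) a.
pose eta := `|z - G a|.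
have h2 : 0 < (2 : C) by rewrite ltr0n.
have half_ge0 n : 0 <= 2^-1 ^+ n :> C by rewrite exprn_ge0// invr_ge0.
have eta2 : eta * 2 < r / 2.
  by rewrite -ltr_pdivlMr// -mulrA -invfM -natrM.
have uS n : u n.+1 = u n + (z - G (u n)) by [].
have ball2 x b : `|x - a| <= eta * 2 * (1 - 2^-1 ^+ b) -> `|x - a| < r / 2.
  move=> H; apply: le_lt_trans H _; apply: le_lt_trans eta2.
  by rewrite ler_piMr ?mulr_ge0// ?normr_ge0 ?(ltW h2)// gerBl.
have ball1 x b : `|x - a| <= eta * 2 * (1 - 2^-1 ^+ b) -> `|x - a| < r.
  move=> /ball2 H; apply: lt_trans H _.
  by rewrite ltr_pdivrMr// mulr_natr mulr2n ltrDl.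
have Hu n : `|u n - a| <= eta * 2 * (1 - 2^-1 ^+ n) /\
    `|u n.+1 - u n| <= eta * 2^-1 ^+ n.
  elim: n => [|n [IH1 IH2]].
    split; first by rewrite {1}/u /= subrr normr0 expr0 subrr mulr0.
    by rewrite uS addrC addKr expr0 mulr1.
  have IH3 : `|u n.+1 - a| <= eta * 2 * (1 - 2^-1 ^+ n.+1).
    rewrite -[u n.+1](subrK (u n)) -addrA; apply: le_trans (ler_normD _ _) _.
    apply: le_trans (lerD IH2 IH1) _; rewrite le_eqVlt; apply/orP; left; apply/eqP.
    by rewrite exprS; field.
  split=> //.
  have -> : u n.+2 - u n.+1 = - (G (u n.+1) - G (u n) - (u n.+1 - u n)).
    have -> : u n.+1 - u n = z - G (u n) by rewrite uS addrC addKr.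
    by rewrite uS [LHS]addrC addKr !opprB addrA subrK.
  rewrite normrN; apply: le_trans (nG _ _ (ball1 _ _ IH3) (ball1 _ _ IH1)) _.
  by rewrite exprS mulrCA ler_wpM2l// invr_ge0 ltW.
have [l ul] := mx_cvg_geometric (fun n => (Hu n).2).
have lr : `|l - a| < r.
  have /cvgrPdist_lt/(_ (r / 2) (divr_gt0 r0 h2))/filter_ex[n /= ln] := ul.
  rewrite -(subrK (u n) l) -addrA; apply: le_lt_trans (ler_normD _ _) _.
  by rewrite [r]splitr ltrD// (ball2 _ _ (Hu n).1).
exists l => //; apply/eqP; rewrite -subr_eq0 -normr_eq0; apply/negPn/negP => e0.
have {e0} : 0 < `|G l - z| by rewrite lt_def e0 normr_ge0.
set e := `|_| => e0.
have e4 : 0 < e / 4 by rewrite divr_gt0// ltr0n.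
have /cvgrPdist_lt/(_ _ e4)[N _ HN] := ul.
have lN := HN N (leqnn N); have lN1 := HN N.+1 (leqnSn N).
suff : e < e by rewrite ltxx.
(* Two quarters bound [G l - G (u N)], since [G] is close to the identity and [u N] to [l]; the
   other two bound [G (u N) - z], which is [u N - u N.+1]. *)
have eE : e = (e / 4 + e / 4) + (e / 4 + e / 4) by field.
rewrite [ltRHS]eE {1}/e -(subrK (G (u N)) (G l)) -addrA.
apply: le_lt_trans (ler_normD _ _) _; apply: ltrD.
  rewrite -(subrK (l - u N) (G l - G (u N))); apply: le_lt_trans (ler_normD _ _) _.
  apply: ltrD => //; apply: le_lt_trans (nG _ _ lr (ball1 _ _ (Hu N).1)) _.
  by apply: le_lt_trans lN; rewrite ler_piMl// invf_le1 ?ler1n ?ltr0n.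
have -> : G (u N) - z = - (u N.+1 - l + (l - u N)).
  by rewrite subrKA uS [u N + _]addrC addrK opprB.
rewrite normrN; apply: le_lt_trans (ler_normD _ _) _.
by rewrite ltrD// distrC.
Qed.

End Differentiable.
(** The differential of [S] is that of [zeta] followed by a left inverse [M] of [L], and the error
    of [S] is [M] applied to the errors of [zeta] and [G]. The Lipschitz bound on [S] turns the
    error of [G] into one in terms of the parameter. *)
Lemma strict_diff_inverse p q m n (G : 'M[C]_(p, q) -> 'M[C]_(p, q))
    (S zeta : 'M[C]_(m, n) -> 'M[C]_(p, q)) v L Z N : nbhs v N ->
  (forall w w', N w -> N w' -> `|S w - S w'| <= 2 * `|zeta w - zeta w'|) ->
  (forall w, N w -> G (S w) = zeta w) ->
  strict_diff G (S v) L -> (forall x, L x = 0 -> x = 0) ->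
  strict_diff zeta v Z -> exists l, strict_diff S v l.
Proof.
move=> vN SN GS [lL HG] L0 sz; have [lZ Hz] := sz.
have [M lM ML] := linear_inj_inverse lL L0.
have [d d0 Md] := mx_linear_bounded lM.
have [c c0 [N' vN' Hc]] := strict_diff_lipschitz sz.
have MB := linear_morphB lM.
exists (M \o Z); apply: (@strict_diff_bigO _ _ _ _ _ _ _ (d * (2 * c) + d)).
- by move=> e x y; rewrite /= lZ lM.
- by rewrite addr_ge0// !mulr_ge0// ltr0n.
move=> e e0 _; have [N1 vN1 HN1] := HG e e0; have [N2 vN2 HN2] := Hz e e0.
have [P vP HP] : exists2 P, nbhs v P & forall w, P w -> N1 (S w).
  have /nbhs_ballP[r r0 rN1] := vN1.
  have r4 : 0 < r / 4 by rewrite divr_gt0// ltr0n.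
  have [P vP HP] := strict_diff_near sz r4.
  exists (P `&` N); first exact: filterI.
  move=> w [/HP Pw Nw]; apply: rN1; rewrite -ball_normE /= distrC.
  apply: le_lt_trans (SN w v Nw (nbhs_singleton vN)) _.
  apply: (@le_lt_trans _ _ (2 * (r / 4))); first by rewrite ler_wpM2l// ler0n.
  have -> : 2 * (r / 4) = r / 2 by field.
  by rewrite ltr_pdivrMr ?ltr0n// mulr_natr mulr2n ltrDl.
exists (N `&` N' `&` N2 `&` P); first by do !apply: filterI.
move=> x y [[[x1 x2] x3] x4] [[[y1 y2] y3] y4] /=.
have -> : S x - S y - M (Z (x - y)) =
    M (zeta x - zeta y - Z (x - y)) - M (G (S x) - G (S y) - L (S x - S y)).
  rewrite (GS x x1) (GS y y1) -[RHS]MB -{1}[S x - S y]ML -MB.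
  by congr (M _); rewrite opprB [RHS]addrC subrKA.
apply: le_trans (ler_normB _ _) _; rewrite addrC [_ * e]mulrDl [leRHS]mulrDl; apply: lerD.
  apply: le_trans (Md _) _; rewrite -!mulrA ler_wpM2l//.
  apply: le_trans (HN1 _ _ (HP _ x4) (HP _ y4)) _.
  rewrite [leRHS]mulrA [leRHS]mulrCA ler_wpM2l ?(ltW e0)//.
  by apply: le_trans (SN _ _ x1 y1) _; rewrite -mulrA ler_wpM2l ?ler0n// Hc.
by apply: le_trans (Md _) _; rewrite -!mulrA ler_wpM2l// HN2.
Qed.

End InverseFunction.

Section MatrixCalculus.
Variables (R : realType) (p q : nat).
Local Notation C := (Cplx R).
Local Notation E := 'M[C]_(p, q).
Variable a : E.

Lemma strict_diff_mulmx m n r (F L : E -> 'M[C]_(m, n)) (G K : E -> 'M[C]_(n, r)) :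
  strict_diff F a L -> strict_diff G a K ->
  strict_diff (fun x => F x *m G x) a (fun x => L x *m G a + F a *m K x).
Proof.
(* The norm is the largest modulus of an entry, so the bound on a product carries the inner
   dimension [n] as a factor. *)
apply: (@strict_diff_bilinear _ _ _ _ _ _ _ _ _ _ _ (@mulmx _ m n r) n%:R).
- by move=> v c x y; rewrite mulmxDl -scalemxAl.
- by move=> v c x y; rewrite mulmxDr -scalemxAr.
- by rewrite ler0n.
move=> v w; apply: mx_norm_le => [|i j]; first by rewrite !mulr_ge0 ?ler0n.
rewrite mxE; apply: le_trans (ler_norm_sum _ _ _) _.
apply: (@le_trans _ _ (\sum_(s < n) `|v| * `|w|)).
  by apply: ler_sum => s _; rewrite normrM ler_pM// mx_entry_norm.
by rewrite sumr_const card_ord -[_ * _ *+ _]mulr_natl mulrA.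
Qed.

Lemma strict_diffM (f g l k : E -> C) :
  strict_diff f a l -> strict_diff g a k ->
  strict_diff (fun x => f x * g x) a (fun x => l x * g a + f a * k x).
Proof.
apply: (@strict_diff_bilinear _ _ _ _ C C C _ _ _ _ *%R 1) => //.
- by move=> v c x y; rewrite mulrDl -scalerAl.
- by move=> v c x y; rewrite mulrDr -scalerAr.
- by move=> v w; rewrite mul1r normrM.
Qed.

Lemma strict_diffZ m n (f l : E -> C) (G K : E -> 'M[C]_(m, n)) :
  strict_diff f a l -> strict_diff G a K ->
  strict_diff (fun x => f x *: G x) a (fun x => l x *: G a + f a *: K x).
Proof.
apply: (@strict_diff_bilinear _ _ _ _ C _ _ _ _ _ _ *:%R 1) => //.
- by move=> v c x y; rewrite scalerDl scalerA.
- by move=> v c x y; rewrite scalerDr !scalerA mulrC.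
- by move=> v w; rewrite mul1r normrZ.
Qed.

Lemma strict_diff_postmx m n (W : normedModType C) (F L : E -> 'M[C]_(m, n))
    (u : 'M[C]_(m, n) -> W) :
  linear u -> strict_diff F a L -> strict_diff (u \o F) a (u \o L).
Proof.
by move=> lu; have [d d0 ud] := mx_linear_bounded lu; exact: strict_diff_post ud.
Qed.

Lemma strict_diffB (W : normedModType C) (f g l k : E -> W) :
  strict_diff f a l -> strict_diff g a k ->
  strict_diff (fun x => f x - g x) a (fun x => l x - k x).
Proof.
move=> sf sg; apply: strict_diffD => //.
apply: (@strict_diff_post _ _ _ _ _ _ _ _ -%R 1) sg => //.
  by move=> c x y; rewrite opprD scalerN.
by move=> x; rewrite normrN mul1r.
Qed.

Lemma strict_diff_tr n (F L : E -> 'M[C]_n) : strict_diff F a L ->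
  strict_diff (fun x => \tr (F x)) a (fun x => \tr (L x)).
Proof.
apply: (@strict_diff_postmx _ _ C _ _ (fun M => \tr M)).
by move=> c x y; rewrite linearP.
Qed.

Lemma strict_diff_entry m n (F L : E -> 'M[C]_(m, n)) i j : strict_diff F a L ->
  strict_diff (fun x => F x i j) a (fun x => L x i j).
Proof.
apply: (@strict_diff_postmx _ _ C _ _ (fun M => M i j)).
by move=> c x y; rewrite !mxE.
Qed.

Lemma strict_diff_mx m n (F L : E -> 'M[C]_(m, n)) :
  (forall i j, strict_diff (fun x => F x i j) a (fun x => L x i j)) ->
  strict_diff F a L.
Proof.
move=> H; split.
  move=> c x y; apply/matrixP => i j; rewrite !mxE.
  by have [lL _] := H i j; rewrite lL.
move=> e e0.
have nb i j : {N | nbhs a N & forall x y, N x -> N y ->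
    `|F x i j - F y i j - L (x - y) i j| <= e * `|x - y|}.
  by apply: cid2; have [_ /(_ e e0)] := H i j.
have aN : \forall x \near a, forall i j, s2val (nb i j) x.
  apply: (@filter_forall _ _ _ _ (nbhs_filter a)) => i.
  by apply: (@filter_forall _ _ _ _ (nbhs_filter a)) => j; exact: (s2valP (nb i j)).
exists [set x | forall i j, s2val (nb i j) x] => //.
move=> x y Nx Ny; apply: mx_norm_le => [|i j]; first by rewrite mulr_ge0// ltW.
by rewrite !mxE; exact: (s2valP' (nb i j)).
Qed.

Lemma strict_diffV (f l : E -> C) : f a = 1 -> strict_diff f a l ->
  strict_diff (fun x => (f x)^-1) a (fun x => - l x).
Proof.
move=> fa sf; have [ll Hf] := sf; have [c c0 lc] := mx_linear_bounded ll.
have h2 : 0 < 2 :> C by rewrite ltr0n.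
(* Near [a] one has [1 / 2 <= |f x| <= 2]: the 4 bounds the product of two inverses, and the 3 comes
   from [|f x| * |f y - 1| + |f x - 1| <= 3 * e]. *)
apply: (@strict_diff_bigO _ _ _ _ C _ _ (4 * (1 + c * 3))).
- by move=> e x y; rewrite ll opprD scalerN.
- by rewrite mulr_ge0 ?ler0n// addr_ge0// mulr_ge0// ler0n.
move=> e e0 e1; have [N1 aN1 HN1] := Hf e e0.
have [N2 aN2 HN2] := strict_diff_near sf (divr_gt0 e0 h2).
exists (N1 `&` N2); first exact: filterI.
have fN x : N2 x -> [/\ `|f x - 1| <= e, `|f x| <= 2, f x != 0 & `|(f x)^-1| <= 2].
  move=> /HN2; rewrite fa => fx.
  have fe : `|f x - 1| <= e by apply: le_trans fx _; rewrite ler_pdivrMr// mulr_natr mulr2n lerDl ltW.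
  have half : 2^-1 <= `|f x|.
    have : `|1 : C| <= `|f x| + 2^-1.
      rewrite -[X in `|X|](subKr (f x)); apply: le_trans (ler_normB _ _) _.
      by rewrite lerD2l; apply: le_trans fx _; rewrite ler_piMl// invr_ge0 ltW.
    by rewrite normr1 {1}[1](splitr 1) mul1r lerD2r.
  have f0 : f x != 0.
    by rewrite -normr_gt0; apply: lt_le_trans half; rewrite invr_gt0.
  split=> //; last by rewrite normfV -[leRHS]invrK lef_pV2// posrE ?invr_gt0// normr_gt0.
  rewrite -(subrK 1 (f x)); apply: le_trans (ler_normD _ _) _.
  by rewrite normr1 mulr2n lerD// (le_trans fe).
move=> x y [x1 /fN[x2 x3 x4 x5]] [y1 /fN[y2 y3 y4 y5]].
have -> : (f x)^-1 - (f y)^-1 - (- l (x - y)) =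
    (f x)^-1 * (f y)^-1 *
    (- (f x - f y - l (x - y)) + l (x - y) * (f x * (f y - 1) + (f x - 1))).
  by field; rewrite x4 y4.
rewrite normrM -!mulrA ler_pM// ?normr_ge0//.
  by rewrite normrM; have -> : 4 = 2 * 2 :> C by [rewrite -natrM]; rewrite ler_pM.
apply: le_trans (ler_normD _ _) _; rewrite mulrDl mul1r lerD// ?normrN ?HN1//.
rewrite normrM [leRHS](_ : _ = (c * `|x - y|) * (3 * e)); last by ring.
rewrite ler_pM//; apply: le_trans (ler_normD _ _) _.
rewrite (_ : 3 * e = 2 * e + e); last by ring.
by rewrite lerD// normrM ler_pM.
Qed.
End MatrixCalculus.

(** * Traces of words and their differentials *)

Section PairSums.
Variables (C : pzRingType) (T : Type) (t0 : T) (phi : T -> C).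
Implicit Types (c : nat -> C) (s : seq T).

Lemma sum_nth_cons c t s :
  \sum_(0 <= j < size (t :: s)) c j * phi (nth t0 (t :: s) j) =
  c 0%N * phi t + \sum_(0 <= j < size s) c j.+1 * phi (nth t0 s j).
Proof. by rewrite big_nat_recl. Qed.

Lemma sum_nth_cat c s s' :
  \sum_(0 <= j < size (s ++ s')) c j * phi (nth t0 (s ++ s') j) =
  \sum_(0 <= j < size s) c j * phi (nth t0 s j)
  + \sum_(0 <= j < size s') c (size s + j)%N * phi (nth t0 s' j).
Proof.
elim: s c => [|t s IH] c; first by rewrite /= [X in _ = X + _]big_geq// add0r.
by rewrite cat_cons !sum_nth_cons (IH (fun j => c j.+1)) addrA.
Qed.

Lemma sum_nth_pairs c (f g : nat -> T) m n :
  let s := flatten [seq [:: f i; g i] | i <- index_iota m n] in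
  \sum_(0 <= j < size s) c j * phi (nth t0 s j) =
  \sum_(m <= i < n) (c (2 * (i - m))%N * phi (f i) + c (2 * (i - m)).+1 * phi (g i)).
Proof.
rewrite /= /index_iota; move: {n}(n - m)%N => d.
suff H b : \sum_(0 <= j < size (flatten [seq [:: f i; g i] | i <- iota (b + m) d]))
      c (2 * b + j)%N * phi (nth t0 (flatten [seq [:: f i; g i] | i <- iota (b + m) d]) j) =
    \sum_(i <- iota (b + m) d)
      (c (2 * (i - m))%N * phi (f i) + c (2 * (i - m)).+1 * phi (g i)).
  exact: (H 0%N).
elim: d b => [|d IH] b; first by rewrite /= big_geq ?big_nil.
set s := flatten _; have -> : s = f (b + m)%N :: g (b + m)%N ::
    flatten [seq [:: f i; g i] | i <- iota (b + m).+1 d] by [].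
rewrite (sum_nth_cons (fun j => c (2 * b + j)%N)).
rewrite (sum_nth_cons (fun j => c (2 * b + j.+1)%N)) big_cons -addrA.
have := IH b.+1; rewrite addSn => <-.
rewrite addnK addn0 addn1; congr (_ + (_ + _)).
by apply: eq_bigr => j _; congr (c _ * _); lia.
Qed.
End PairSums.

Section Words.
Variables (C : fieldType) (k : nat).
Local Notation E := 'M[C]_(k, 3 * 3).
Implicit Types (x h : E) (A B H : 'M[C]_3) (l : nat * bool) (w : seq (nat * bool)).

(* As for [gen], indices start at 1, and generators of index out of range
   are trivial. *)
Definition gmx x (i : nat) : 'M[C]_3 :=
  if insub i.-1 is Some j then vec_mx (row (j : 'I_k) x) else 1.

Definition dgmx h (i : nat) : 'M[C]_3 :=
  if insub i.-1 is Some j then vec_mx (row (j : 'I_k) h) else 0.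

(** [(i, true)] encodes the inverse of the generator of index [i]. With [adj3], the trace of a word
    is a polynomial on all tuples of matrices and can be differentiated in every direction. *)
Definition letter x l := if l.2 then adj3 (gmx x l.1) else gmx x l.1.

Fixpoint word_mx x w : 'M[C]_3 :=
  if w is l :: w' then letter x l * word_mx x w' else 1.

Definition dletter x h l :=
  if l.2 then dadj3 (gmx x l.1) (dgmx h l.1) else dgmx h l.1.

Fixpoint dword_mx x h w : 'M[C]_3 :=
  if w is l :: w' then dletter x h l * word_mx x w' + letter x l * dword_mx x h w'
  else 0.

Definition sl_tuple x := forall j, \det (vec_mx (row j x) : 'M[C]_3) = 1.

Lemma det_gmx x i : sl_tuple x -> \det (gmx x i) = 1.
Proof. by rewrite /gmx => slx; case: insubP => [j _ _|_]; rewrite ?det1. Qed.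

(** The inverse of the conjugating matrix is an argument of its own, tied to it by [A * B = 1] in
    the lemmas; [A] may have any nonzero determinant. *)
Definition conj_tuple A B x : E := \matrix_(j < k) mxvec (A *m vec_mx (row j x) *m B).

Lemma gmx_conj A B x i : A * B = 1 -> gmx (conj_tuple A B x) i = A * gmx x i * B.
Proof.
rewrite /gmx => AB; case: insubP => [j _ _|_]; last by rewrite mulr1.
by rewrite rowK mxvecK.
Qed.

Lemma sl_tuple_conj A B x : A * B = 1 -> sl_tuple x -> sl_tuple (conj_tuple A B x).
Proof.
move=> AB slx j; rewrite rowK mxvecK !det_mulmx slx mulr1 -det_mulmx.
by rewrite [A *m B]AB det1.
Qed.

Lemma letter_conj A B x l : A * B = 1 -> sl_tuple x ->
  letter (conj_tuple A B x) l = A * letter x l * B.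
Proof.
move=> AB slx; have BA : B * A = 1 by apply: mulmx1C.
rewrite /letter !gmx_conj//; case: (l.2) => //; set X := gmx x _.
have dX : \det X = 1 by exact: det_gmx.
have dY : \det (A * X * B) = 1.
  by rewrite -gmx_conj//; apply: det_gmx; exact: sl_tuple_conj.
have XX := adj3_sl dX; have YY : adj3 _ * _ = 1 := mulmx1C (adj3_sl dY).
rewrite -[LHS]mulr1 -[X in _ * X](_ : (A * X * B) * (A * adj3 X * B) = 1).
  by rewrite mulrA YY mul1r.
by rewrite !mulrA -(mulrA _ B A) BA mulr1 -(mulrA _ X) XX mulr1.
Qed.

Lemma word_mx_conj A B x w : A * B = 1 -> sl_tuple x ->
  word_mx (conj_tuple A B x) w = A * word_mx x w * B.
Proof.
move=> AB slx; have BA : B * A = 1 by apply: mulmx1C.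
elim: w => [|l w IH] /=; first by rewrite mulr1.
by rewrite IH letter_conj// !mulrA -(mulrA _ B A) BA mulr1.
Qed.

Definition tr_word x w : C := \tr (word_mx x w).

Lemma tr_word_conj A B x w : A * B = 1 -> sl_tuple x ->
  tr_word (conj_tuple A B x) w = tr_word x w.
Proof.
move=> AB slx; rewrite /tr_word word_mx_conj// tr_mulC mulrA.
by rewrite (mulmx1C AB : B * A = 1) mul1r.
Qed.

(** The tangent vector at [x] to the conjugation orbit, in the direction [A]. *)
Definition ad_tuple x A : E :=
  \matrix_(j < k) mxvec (A *m vec_mx (row j x) - vec_mx (row j x) *m A).

Lemma dgmx_ad x A i : dgmx (ad_tuple x A) i = A * gmx x i - gmx x i * A.
Proof.
rewrite /dgmx /gmx; case: insubP => [j _ _|_]; first by rewrite rowK mxvecK.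
by rewrite mulr1 mul1r subrr.
Qed.

Lemma dword_ad x A w : dword_mx x (ad_tuple x A) w = A * word_mx x w - word_mx x w * A.
Proof.
have dl l : dletter x (ad_tuple x A) l = A * letter x l - letter x l * A.
  by rewrite /dletter /letter dgmx_ad; case: (l.2) => //; rewrite dadj3_comm.
elim: w => [|l w IH] /=; first by rewrite mulr1 mul1r subrr.
by rewrite IH dl mulrBl mulrBr !mulrA addrA subrK.
Qed.

Definition single_tuple j H : E := \matrix_(j' < k) if j' == j then mxvec H else 0.

Lemma dgmx_single j H i : (0 < i)%N ->
  dgmx (single_tuple j H) i = if i == j.+1 then H else 0.
Proof.
rewrite /dgmx; case: i => // i _ /=; case: insubP => [j' _ <-|].
  by rewrite rowK eqSS val_eqE; case: eqP => _; rewrite ?mxvecK ?linear0.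
by rewrite -leqNgt eqSS; case: eqP => // -> /(leq_trans (ltn_ord j)); rewrite ltnn.
Qed.

Definition comm_diff x i :=
  tr_word x [:: (1, false); (i, false); (1, true); (i, true)]%N
  - tr_word x [:: (i, false); (1, false); (i, true); (1, true)]%N.

Definition delta_tuple x i :=
  (tr_word x [:: (1, false); (2, false); (i, false)]%N
   - tr_word x [:: (1, false); (i, false); (2, false)]%N)
  * (tr_word x [:: (1, true); (2, true); (i, true)]%N
     - tr_word x [:: (1, true); (i, true); (2, true)]%N)
  - (tr_word x [:: (1, false); (2, true); (i, true)]%N
     - tr_word x [:: (1, false); (i, true); (2, true)]%N)
  * (tr_word x [:: (1, true); (2, false); (i, false)]%N
     - tr_word x [:: (1, true); (i, false); (2, false)]%N).

Lemma comm_diffE x i :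
  comm_diff x i = trcomm (gmx x 1) (adj3 (gmx x 1)) (gmx x i) (adj3 (gmx x i)).
Proof. by rewrite /comm_diff /tr_word /= /letter /= !mulr1 !mulrA. Qed.

Lemma delta_tupleE x i : delta_tuple x i =
  trDelta (gmx x 1) (adj3 (gmx x 1)) (gmx x 2) (adj3 (gmx x 2)) (gmx x i) (adj3 (gmx x i)).
Proof. by rewrite /delta_tuple /tr_word /= /letter /= !mulr1 !mulrA. Qed.

Definition noncritical x :=
  (forall i, (2 <= i <= k)%N -> comm_diff x i != 0) /\
  (forall i, (3 <= i <= k)%N -> delta_tuple x i != 0).

(** The elements of [trace_words], in the same order, as formal words, which can be differentiated
    letter by letter. *)
Definition trace_seq : seq (seq (nat * bool)) := (
  flatten [seq [:: [:: (i, false)]; [:: (i, true)]] | i <- index_iota 1 k.+1]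
  ++ flatten [seq [:: [:: (1, false); (i, false)]; [:: (1, true); (i, true)]]
               | i <- index_iota 2 k.+1]
  ++ flatten [seq [:: [:: (2, false); (i, false)]; [:: (2, true); (i, true)]]
               | i <- index_iota 3 k.+1]
  ++ flatten [seq [:: [:: (1, false); (i, true)]; [:: (1, true); (i, false)]]
               | i <- index_iota 2 k.+1])%N.

Lemma size_flatten_pairs (T : Type) (f g : nat -> T) s :
  size (flatten [seq [:: f i; g i] | i <- s]) = (2 * size s)%N.
Proof. by elim: s => //= i s ->; rewrite mulnS. Qed.

Lemma size_trace_seq : (3 <= k)%N -> size trace_seq = (8 * k - 8)%N.
Proof. by move=> k3; rewrite !size_cat !size_flatten_pairs !size_iota; lia. Qed.

End Words.

Lemma mul_scale (C : fieldType) (c : C) (A B : 'M[C]_3) : A * (c *: B) = c *: (A * B).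
Proof. by rewrite -[LHS]/(A *m _) -scalemxAr. Qed.

Lemma tr_orth (C : fieldType) (M : 'M[C]_3) : (forall H : 'M[C]_3, \tr (M * H) = 0) -> M = 0.
Proof.
move=> M0; apply/matrixP => s t; rewrite mxE -(M0 (delta_mx t s)) -[_ * _]/(_ *m _).
rewrite /mxtrace (bigD1 s)//= big1 ?addr0 => [|r rs]; last first.
  by rewrite mxE big1// => u _; rewrite mxE (negPf rs) andbF mulr0.
rewrite mxE (bigD1 t)//= big1 ?addr0 => [|u ut]; last first.
  by rewrite mxE (negPf ut) mulr0.
by rewrite mxE !eqxx mulr1.
Qed.

(** The left-hand side pairs [H] with a fixed matrix, which vanishes because the trace form is
    nondegenerate; the conclusion is this matrix multiplied by [X] on the left. *)
Lemma functional_relation (C : fieldType) (c : C) (X Z N M : 'M[C]_3) : X * Z = 1 ->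
  (forall H : 'M[C]_3, c * \tr (Z * H) + \tr (N * H)
     + \tr (M * (\tr (Z * H) *: Z - Z * H * Z)) = 0) ->
  (c + \tr (M * Z)) *: 1 + X * N - M * Z = 0.
Proof.
move=> XZ H0; have : (c + \tr (M * Z)) *: Z + N - Z * M * Z = 0.
  apply: tr_orth => H; rewrite -[RHS](H0 H) mulrBr trB mul_scale mxtraceZ.
  rewrite mulrBl mulrDl trB mxtraceD -scalerAl mxtraceZ mulrDl -!addrA; congr (_ + _).
  rewrite addrCA; congr (_ + _); rewrite mulrC; congr (_ - _).
  by rewrite !mulrA; cyc.
move=> /(congr1 (fun M => X * M)); rewrite mulr0 => E0; rewrite -[RHS]E0.
by rewrite mulrBr mulrDr mul_scale !mulrA XZ mul1r.
Qed.

Lemma tr_comb4 (C : fieldType) (c1 c2 c3 c4 : C) (P1 P2 P3 P4 H : 'M[C]_3) :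
  \tr ((c1 *: P1 + c2 *: P2 + c3 *: P3 + c4 *: P4) * H) =
  c1 * \tr (P1 * H) + c2 * \tr (P2 * H) + c3 * \tr (P3 * H) + c4 * \tr (P4 * H).
Proof. by rewrite !mulrDl -!scalerAl !mxtraceD !mxtraceZ. Qed.

(** * Independence of the differentials of determinants and traces *)

Section Jacobian.
Variables (C : fieldType) (k : nat).
Local Notation E := 'M[C]_(k, 3 * 3).
Variable x : E.
Hypotheses (k3 : (3 <= k)%N) (slx : sl_tuple x) (ncx : noncritical x).
Variables (cd ct : nat -> C).

Let phi (h : E) w := \tr (dword_mx x h w).
(* Coefficients of the traces of [g_i], [g_i^-1], [g_1 g_i], [g_1^-1 g_i^-1],
   [g_2 g_i], [g_2^-1 g_i^-1], [g_1 g_i^-1] and [g_1^-1 g_i], in this order. *)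
Let a i := ct (2 * (i - 1))%N.
Let a' i := ct (2 * (i - 1)).+1.
Let b i := ct (2 * k + 2 * (i - 2))%N.
Let b' i := ct (2 * k + (2 * (i - 2)).+1)%N.
Let d i := ct (2 * k + (2 * (k - 1) + 2 * (i - 3)))%N.
Let d' i := ct (2 * k + (2 * (k - 1) + (2 * (i - 3)).+1))%N.
Let e i := ct (2 * k + (2 * (k - 1) + (2 * (k - 2) + 2 * (i - 2))))%N.
Let e' i := ct (2 * k + (2 * (k - 1) + (2 * (k - 2) + (2 * (i - 2)).+1)))%N.

Lemma trace_seq_sum h :
  \sum_(0 <= j < size (trace_seq k)) ct j * phi h (nth [::] (trace_seq k) j) =
  \sum_(1 <= i < k.+1)
    (a i * phi h [:: (i, false)] + a' i * phi h [:: (i, true)])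
  + (\sum_(2 <= i < k.+1) (b i * phi h [:: (1%N, false); (i, false)]
      + b' i * phi h [:: (1%N, true); (i, true)])
  + (\sum_(3 <= i < k.+1) (d i * phi h [:: (2%N, false); (i, false)]
      + d' i * phi h [:: (2%N, true); (i, true)])
  + \sum_(2 <= i < k.+1) (e i * phi h [:: (1%N, false); (i, true)]
      + e' i * phi h [:: (1%N, true); (i, false)]))).
Proof.
rewrite /trace_seq sum_nth_cat (sum_nth_cat _ _ (fun j => ct (_ + j)%N)).
rewrite (sum_nth_cat _ _ (fun j => ct (_ + (_ + j))%N)).
rewrite sum_nth_pairs (sum_nth_pairs _ _ (fun j => ct (_ + j)%N)).
rewrite (sum_nth_pairs _ _ (fun j => ct (_ + (_ + j))%N)).
rewrite (sum_nth_pairs _ _ (fun j => ct (_ + (_ + (_ + j)))%N)).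
by rewrite !size_flatten_pairs !size_iota !subSS subn0.
Qed.

Hypothesis J0 : forall h,
  \sum_(1 <= i < k.+1) cd i * \tr (adj3 (gmx x i) * dgmx h i)
  + \sum_(0 <= j < size (trace_seq k)) ct j * phi h (nth [::] (trace_seq k) j) = 0.

Lemma sum_single m n i (F : nat -> C) : (m <= i < n)%N ->
  (forall j, (m <= j < n)%N -> j != i -> F j = 0) -> \sum_(m <= j < n) F j = F i.
Proof.
move=> mi F0; rewrite (bigD1_seq i) ?mem_index_iota ?iota_uniq//=.
by rewrite big_seq_cond big1 ?addr0// => j; rewrite mem_index_iota => /andP[/F0].
Qed.

Let X := gmx x.
Let Y i := adj3 (gmx x i).
Let XY i : X i * Y i = 1. Proof. by apply: adj3_sl; exact: det_gmx. Qed.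
Let CH i : X i * X i = \tr (X i) *: X i - tr2 (X i) *: 1 + Y i.
Proof. exact: sqr_adj3. Qed.

(* The component along the [i]-th factor of the relation between the
   differentials, multiplied by [X i] on the left. *)
Lemma component_relation i c (N M : 'M[C]_3) :
  (forall H : 'M[C]_3, c * \tr (Y i * H) + \tr (N * H) + \tr (M * dadj3 (X i) H) = 0) ->
  (c + \tr (M * Y i)) *: 1 + X i * N - M * Y i = 0.
Proof.
move=> H0; apply: functional_relation (XY i) _ => H.
by rewrite -[RHS](H0 H) dadj3_sl ?det_gmx.
Qed.

Let phi1 h l : phi h [:: l] = \tr (dletter x h l).
Proof. by rewrite /phi /= mulr1 mulr0 addr0. Qed.

Let phi2 h l l' :
  phi h [:: l; l'] = \tr (dletter x h l * letter x l') + \tr (letter x l * dletter x h l').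
Proof. by rewrite /phi /= !mulr1 mulr0 addr0 mxtraceD. Qed.

Let dadj30 Z : dadj3 Z 0 = 0 :> 'M[C]_3.
Proof.
rewrite /dadj3 mul0mx mulmx0 mxtrace0 scale0r scaler0 mulr0 !subr0 !addr0.
by apply/matrixP => s t; rewrite !mxE mul0rn addr0.
Qed.

Let dletter0 h l : dgmx h l.1 = 0 -> dletter x h l = 0.
Proof. by rewrite /dletter => ->; rewrite dadj30; case: (l.2). Qed.

Let single i (ik : (0 < i <= k)%N) H : exists2 h : E, dgmx h i = H &
  forall j, (0 < j)%N -> j != i -> dgmx h j = 0.
Proof.
case: i ik => // i /= ik; exists (single_tuple (Ordinal ik) H).
  by rewrite dgmx_single// eqxx.
by move=> j j0 ji; rewrite dgmx_single// (negPf ji).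
Qed.

(** For [i >= 3], the generator of index [i] occurs in a word at most once, alone or with one letter
    from the first two generators. Varying the [i]-th factor alone therefore gives a relation of the
    shape of [indep9]: [N] collects the words that contain the generator itself, [M] those that
    contain its inverse. *)
Lemma coef_ge3 i : (3 <= i <= k)%N -> cd i = 0 /\
  [/\ a i = 0, b i = 0, e' i = 0 & d i = 0] /\
  [/\ a' i = 0, b' i = 0, e i = 0 & d' i = 0].
Proof.
move=> /andP[i3 ik].
pose N := a i *: 1 + b i *: X 1 + e' i *: Y 1 + d i *: X 2.
pose M := a' i *: 1 + b' i *: Y 1 + e i *: X 1 + d' i *: Y 2.
have ci : comm_diff x i != 0 by apply: ncx.1; lia.
rewrite comm_diffE in ci.
have Di : delta_tuple x i != 0 by apply: ncx.2; lia.
rewrite delta_tupleE in Di.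
have rel : (cd i + \tr (M * Y i)) *: 1 + X i * N - M * Y i = 0.
  apply: component_relation => H.
  have ik0 : (0 < i <= k)%N by lia.
  have [h hi hj] := single ik0 H.
  have h1 : dgmx h 1 = 0 by apply: hj => //; lia.
  have h2 : dgmx h 2 = 0 by apply: hj => //; lia.
  rewrite -[RHS](J0 h) trace_seq_sum.
  rewrite (@sum_single 1 k.+1 i) ?hi; [|lia|]; last first.
    by move=> j j1 ji; rewrite hj ?mulr0 ?mxtrace0 ?mulr0//; lia.
  rewrite (@sum_single 1 k.+1 i) ?hi; [|lia|]; last first.
    by move=> j j1 ji; rewrite !phi1 !dletter0 ?hj ?mxtrace0 ?mulr0 ?addr0//=; lia.
  rewrite (@sum_single 2 k.+1 i) ?hi; [|lia|]; last first.
    move=> j j1 ji; rewrite !phi2 !dletter0 ?hj//=; [|lia..].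
    by rewrite !mulr0 !mul0r !mxtrace0 !addr0 !mulr0 addr0.
  rewrite (@sum_single 3 k.+1 i) ?hi; [|lia|]; last first.
    move=> j j1 ji; rewrite !phi2 !dletter0 ?hj//=; [|lia..].
    by rewrite !mulr0 !mul0r !mxtrace0 !addr0 !mulr0 addr0.
  rewrite (@sum_single 2 k.+1 i) ?hi; [|lia|]; last first.
    move=> j j1 ji; rewrite !phi2 !dletter0 ?hj//=; [|lia..].
    by rewrite !mulr0 !mul0r !mxtrace0 !addr0 !mulr0 addr0.
  rewrite !phi1 !phi2 /dletter /letter /= hi h1 h2 !dadj30 !mul0r !mxtrace0 !add0r.
  have -> : \tr (N * H) = a i * \tr H + b i * \tr (X 1 * H) + e' i * \tr (Y 1 * H)
      + d i * \tr (X 2 * H).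
    by rewrite /N tr_comb4 mul1r.
  have -> : \tr (M * dadj3 (X i) H) = a' i * \tr (dadj3 (X i) H)
      + b' i * \tr (Y 1 * dadj3 (X i) H) + e i * \tr (X 1 * dadj3 (X i) H)
      + d' i * \tr (Y 2 * dadj3 (X i) H).
    by rewrite /M tr_comb4 mul1r.
  by rewrite /X /Y; ring.
have [c0 [n0 m0]] := indep9 (XY 1) (XY i) (CH i) ci (or_intror Di) rel.
case: n0 => n0 n1 n2 n3; case: m0 => m0 m1 m2 m3.
split=> //; move: c0; rewrite /M m0 m1 m2 m3 !scale0r !addr0 mul0r mxtrace0 addr0.
by [].
Qed.
Lemma big_nat0 m n (F : nat -> C) : (forall j, (m <= j < n)%N -> F j = 0) ->
  \sum_(m <= j < n) F j = 0.
Proof. by move=> F0; rewrite big_nat_cond big1// => j; rewrite andbT; exact: F0. Qed.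

(** The second generator also occurs in words with a later one, but their coefficients are zero by
    [coef_ge3]. What remains fits [indep9] with zero coefficients at [B] and [B']. *)
Lemma coef_eq2 : cd 2 = 0 /\ [/\ a 2 = 0, b 2 = 0 & e' 2 = 0] /\
  [/\ a' 2 = 0, b' 2 = 0 & e 2 = 0].
Proof.
pose N := a 2 *: 1 + b 2 *: X 1 + e' 2 *: Y 1 + 0 *: X 2.
pose M := a' 2 *: 1 + b' 2 *: Y 1 + e 2 *: X 1 + 0 *: Y 2.
have ci : comm_diff x 2 != 0 by apply: ncx.1; lia.
rewrite comm_diffE in ci.
have rel : (cd 2 + \tr (M * Y 2)) *: 1 + X 2 * N - M * Y 2 = 0.
  apply: component_relation => H.
  have ik0 : (0 < 2 <= k)%N by lia.
  have [h hi hj] := single ik0 H.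
  have h1 : dgmx h 1 = 0 by apply: hj => //; lia.
  rewrite -[RHS](J0 h) trace_seq_sum.
  rewrite (@sum_single 1 k.+1 2) ?hi; [|lia|]; last first.
    by move=> j j1 ji; rewrite hj ?mulr0 ?mxtrace0 ?mulr0//; lia.
  rewrite (@sum_single 1 k.+1 2) ?hi; [|lia|]; last first.
    by move=> j j1 ji; rewrite !phi1 !dletter0 ?hj ?mxtrace0 ?mulr0 ?addr0//=; lia.
  rewrite (@sum_single 2 k.+1 2) ?hi; [|lia|]; last first.
    move=> j j1 ji; rewrite !phi2 !dletter0 ?hj//=; [|lia..].
    by rewrite !mulr0 !mul0r !mxtrace0 !addr0 !mulr0 addr0.
  rewrite (@big_nat0 3); last first.
    move=> j j1; have [|_ [[_ _ _ ->] [_ _ _ ->]]] := @coef_ge3 j; first by lia.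
    by rewrite !mul0r addr0.
  rewrite (@sum_single 2 k.+1 2) ?hi; [|lia|]; last first.
    move=> j j1 ji; rewrite !phi2 !dletter0 ?hj//=; [|lia..].
    by rewrite !mulr0 !mul0r !mxtrace0 !addr0 !mulr0 addr0.
  rewrite !phi1 !phi2 /dletter /letter /= hi h1 !dadj30 !mul0r !mxtrace0 !add0r.
  have -> : \tr (N * H) = a 2 * \tr H + b 2 * \tr (X 1 * H) + e' 2 * \tr (Y 1 * H).
    by rewrite /N tr_comb4 mul1r mul0r addr0.
  have -> : \tr (M * dadj3 (X 2) H) = a' 2 * \tr (dadj3 (X 2) H)
      + b' 2 * \tr (Y 1 * dadj3 (X 2) H) + e 2 * \tr (X 1 * dadj3 (X 2) H).
    by rewrite /M tr_comb4 mul1r mul0r addr0.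
  by rewrite /X /Y; ring.
have [c0 [n0 m0]] := indep9 (XY 1) (XY 2) (CH 2) ci (or_introl (conj erefl erefl)) rel.
case: n0 => n0 n1 n2 n3; case: m0 => m0 m1 m2 m3.
by split=> //; move: c0; rewrite /M m0 m1 m2 !scale0r !addr0 mul0r mxtrace0 addr0.
Qed.

Lemma coef_ge2 i : (2 <= i <= k)%N -> [/\ b i = 0, b' i = 0, e i = 0 & e' i = 0].
Proof.
move=> ik; have [i2|i2] := eqVneq i 2%N.
  by rewrite i2; have [_ [[_ -> ->] [_ -> ->]]] := coef_eq2.
by have [|_ [[_ -> -> _] [_ -> -> _]]] := @coef_ge3 i; first by lia.
Qed.

(** All words of two letters are gone by now. The independence of 1, the first matrix and its
    inverse is read off [indep5], where the second matrix enters with coefficients zero. *)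
Lemma coef_eq1 : [/\ cd 1 = 0, a 1 = 0 & a' 1 = 0].
Proof.
have ci : comm_diff x 2 != 0 by apply: ncx.1; lia.
rewrite comm_diffE in ci.
have rel : (cd 1 + \tr (a' 1 *: 1 * Y 1)) *: 1 + X 1 * (a 1 *: 1) - a' 1 *: 1 * Y 1 = 0.
  apply: component_relation => H.
  have ik0 : (0 < 1 <= k)%N by lia.
  have [h hi hj] := single ik0 H.
  rewrite -[RHS](J0 h) trace_seq_sum.
  rewrite (@sum_single 1 k.+1 1) ?hi; [|lia|]; last first.
    by move=> j j1 ji; rewrite hj ?mulr0 ?mxtrace0 ?mulr0//; lia.
  rewrite (@sum_single 1 k.+1 1) ?hi; [|lia|]; last first.
    by move=> j j1 ji; rewrite !phi1 !dletter0 ?hj ?mxtrace0 ?mulr0 ?addr0//=; lia.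
  rewrite (@big_nat0 2); last first.
    move=> j j1; have [|-> -> _ _] := @coef_ge2 j; first by lia.
    by rewrite !mul0r addr0.
  rewrite (@big_nat0 3); last first.
    move=> j j1; have [|_ [[_ _ _ ->] [_ _ _ ->]]] := @coef_ge3 j; first by lia.
    by rewrite !mul0r addr0.
  rewrite (@big_nat0 2); last first.
    move=> j j1; have [|_ _ -> ->] := @coef_ge2 j; first by lia.
    by rewrite !mul0r addr0.
  rewrite !phi1 /dletter /= hi !addr0 -!scalerAl !mul1r !mxtraceZ.
  by rewrite /X /Y; ring.
have E5 : (cd 1 + \tr (a' 1 *: 1 * Y 1)) *: 1 + a 1 *: X 1 + (- a' 1) *: Y 1
    + 0 *: X 2 + 0 *: Y 2 = 0.
  rewrite -[RHS]rel !scale0r !addr0 mul_scale mulr1 scaleNr; congr (_ - _).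
  by rewrite -scalerAl mul1r.
have [c0 a0 /eqP] := indep5 (XY 1) (XY 2) ci E5.
rewrite oppr_eq0 => /eqP a'0 _ _; split=> //.
by move: c0; rewrite a'0 scale0r mul0r mxtrace0 addr0.
Qed.

Lemma jacobian_coef0 : (forall i, (1 <= i <= k)%N -> cd i = 0) /\
  (forall j, (j < 8 * k - 8)%N -> ct j = 0).
Proof.
have Ha i : (1 <= i <= k)%N -> [/\ cd i = 0, a i = 0 & a' i = 0].
  move=> ik; have [i1|i1] := eqVneq i 1%N; first by rewrite i1; exact: coef_eq1.
  have [i2|i2] := eqVneq i 2%N.
    by rewrite i2; have [-> [[-> _ _] [-> _ _]]] := coef_eq2.
  by have [|-> [[-> _ _ _] [-> _ _ _]]] := @coef_ge3 i; first by lia.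
split=> [i /Ha[]//|j jk].
have Hpar n : n = (2 * n./2)%N \/ n = (2 * n./2).+1%N.
  by have := odd_double_half n; case: (odd n); lia.
(* The four blocks of [trace_seq] start at positions 0, [2 * k], [4 * k - 2] and [6 * k - 6]; parity
   tells the two words of a pair apart. *)
have [j1|j1] := ltnP j (2 * k)%N.
  have [|_ Ha0 Ha1] := Ha (j./2 + 1)%N; first by lia.
  have [->|->] := Hpar j.
    by rewrite -[RHS]Ha0 /a; congr ct; lia.
  by rewrite -[RHS]Ha1 /a'; congr ct; lia.
have [j2|j2] := ltnP j (4 * k - 2)%N.
  have [|Hb Hb' _ _] := @coef_ge2 ((j - 2 * k)./2 + 2)%N; first by lia.
  have [jE|jE] := Hpar (j - 2 * k)%N.
    by rewrite -[RHS]Hb /b; congr ct; lia.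
  by rewrite -[RHS]Hb' /b'; congr ct; lia.
have [j3|j3] := ltnP j (6 * k - 6)%N.
  have [|_ [[_ _ _ Hd] [_ _ _ Hd']]] := @coef_ge3 ((j - (4 * k - 2))./2 + 3)%N.
    by lia.
  have [jE|jE] := Hpar (j - (4 * k - 2))%N.
    by rewrite -[RHS]Hd /d; congr ct; lia.
  by rewrite -[RHS]Hd' /d'; congr ct; lia.
have [|_ _ He He'] := @coef_ge2 ((j - (6 * k - 6))./2 + 2)%N; first by lia.
have [jE|jE] := Hpar (j - (6 * k - 6))%N.
  by rewrite -[RHS]He /e; congr ct; lia.
by rewrite -[RHS]He' /e'; congr ct; lia.
Qed.
End Jacobian.

Lemma linear_mulmx (C : fieldType) m n p (f : 'M[C]_(m, n) -> 'rV[C]_p) :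
  linear f -> exists A : 'M[C]_(m * n, p), forall h, f h = mxvec h *m A.
Proof.
move=> lf; have lg : linear (f \o vec_mx : 'rV[C]_(m * n) -> _).
  by move=> c u v; rewrite /= linearP lf.
pose g : {linear 'rV[C]_(m * n) -> 'rV[C]_p} :=
  HB.pack (f \o vec_mx : 'rV[C]_(m * n) -> _) (GRing.isLinear.Build _ _ _ _ _ lg).
exists (lin1_mx g) => h; rewrite mul_rV_lin1.
by rewrite -[g _]/(f (vec_mx (mxvec h))) mxvecK.
Qed.

Section Differential.
Variables (C : fieldType) (k : nat).
Local Notation E := 'M[C]_(k, 3 * 3).
Implicit Types (x h : E).

(** The differential of the map [theta] given by determinants and traces, in algebraic form over any
    field. *)
Definition dtheta x h : 'rV[C]_(k + (8 * k - 8)) :=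
  row_mx (\row_(i < k) \tr (adj3 (gmx x i.+1) * dgmx h i.+1))
    (\row_(j < 8 * k - 8) \tr (dword_mx x h (nth [::] (trace_seq k) j))).

Lemma dgmx_linear i : linear (fun h => dgmx h i).
Proof.
move=> c h h'; rewrite /dgmx; case: insubP => [j _ _|_]; last by rewrite scaler0 addr0.
by rewrite !linearP.
Qed.

Lemma dadj3_linear (X : 'M[C]_3) : linear (dadj3 X).
Proof.
move=> c H H'; rewrite /dadj3 mulmxDl mulmxDr -scalemxAl -scalemxAr !mxtraceD !mxtraceZ.
set HX := H *m X; set HX' := H' *m X; set XH := X *m H; set XH' := X *m H'.
apply/matrixP => s t; rewrite !mxE; case: (s == t); rewrite ?mulr1n ?mulr0n; ring.
Qed.

Lemma dletter_linear x l : linear (fun h => dletter x h l).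
Proof.
move=> c h h'; rewrite /dletter; case: (l.2); rewrite dgmx_linear //.
by rewrite dadj3_linear.
Qed.

Lemma dword_linear x w : linear (fun h => dword_mx x h w).
Proof.
move=> c h h'; elim: w => [|l w IH] /=; first by rewrite scaler0 addr0.
by rewrite IH dletter_linear mulrDl mulrDr scalerDr -scalerAl -scalerAr addrACA.
Qed.

Lemma dtheta_linear x : linear (dtheta x).
Proof.
move=> c h h'; rewrite /dtheta scale_row_mx add_row_mx; congr row_mx.
  by apply/rowP => i; rewrite !mxE dgmx_linear mulrDr mul_scale mxtraceD mxtraceZ.
by apply/rowP => i; rewrite !mxE dword_linear mxtraceD mxtraceZ.
Qed.

Lemma ad_tuple_linear x : linear (ad_tuple x).
Proof.
move=> c A B; apply/row_matrixP => i; rewrite [RHS]linearP /= /ad_tuple !rowK.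
set X := vec_mx _.
transitivity (mxvec (c *: (A *m X - X *m A) + (B *m X - X *m B))); last exact: linearP.
congr mxvec; rewrite mulmxDl mulmxDr -scalemxAl -scalemxAr scalerBr.
by rewrite opprD addrACA.
Qed.

Lemma dtheta_ad x A : dtheta x (ad_tuple x A) = 0.
Proof.
rewrite /dtheta -[RHS]row_mx0; congr row_mx; apply/rowP => i; rewrite !mxE.
  rewrite dgmx_ad tr_comm_r//; set X := gmx _ _.
  by rewrite [LHS]adj3_mulmx -mulmx_adj3.
by rewrite dword_ad trB tr_mulC subrr.
Qed.

(** A vector annihilating the image is a linear relation between the coordinates of [dtheta x], and
    [jacobian_coef0] makes it zero. *)
Lemma dtheta_onto x : (3 <= k)%N -> sl_tuple x -> noncritical x ->
  exists2 r : 'rV[C]_(k + (8 * k - 8)) -> E, linear r & cancel r (dtheta x).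
Proof.
move=> k3 slx ncx; have [M HM] := linear_mulmx (dtheta_linear x).
suff /row_fullP[B BM] : row_full M.
  exists (fun v => vec_mx (v *m B)); first by move=> c u v; rewrite mulmxDl -scalemxAl linearP.
  by move=> v; rewrite HM vec_mxK -mulmxA BM mulmx1.
rewrite -col_leq_rank -mxrank_tr row_leq_rank -kermx_eq0; apply/rowV0P => v /sub_kermxP vM.
pose cd i := if insub i.-1 is Some j then v 0 (lshift (8 * k - 8) (j : 'I_k)) else 0.
pose ct j := if insub j is Some j' then v 0 (rshift k (j' : 'I_(8 * k - 8))) else 0.
have [|cd0 ct0] := @jacobian_coef0 _ _ x k3 slx ncx cd ct.
  move=> h; have : dtheta x h *m v^T = 0.
    by rewrite HM -mulmxA -[M]trmxK -trmx_mul vM trmx0 mulmx0.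
  move=> /matrixP/(_ 0 0); rewrite !mxE big_split_ord /= => E0; rewrite -[RHS]E0.
  rewrite size_trace_seq// big_add1 /= !big_mkord; congr (_ + _).
    apply: eq_bigr => i _; rewrite row_mxEl !mxE mulrC; congr (_ * _).
    by rewrite /cd valK.
  apply: eq_bigr => i _; rewrite row_mxEr !mxE mulrC; congr (_ * _).
  by rewrite /ct valK.
apply/rowP => i; rewrite mxE; case: (splitP i) => j ij.
  have := cd0 j.+1; rewrite /cd valK ltn_ord => /(_ isT) <-; congr (v 0 _).
  exact/val_inj.
have := ct0 j (ltn_ord j); rewrite /ct valK => <-; congr (v 0 _).
exact/val_inj.
Qed.
End Differential.

(** * The tangent space of the orbit and a complement *)

Section Slice.
Variables (C : closedFieldType) (k : nat).
Local Notation E := 'M[C]_(k, 3 * 3).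

Lemma commute_scalar (x : E) (A : 'M[C]_3) : (3 <= k)%N -> sl_tuple x -> noncritical x ->
  ad_tuple x A = 0 -> exists c, A = c%:M.
Proof.
move=> k3 slx ncx A0.
have cA i : A * gmx x i = gmx x i * A.
  apply/eqP; rewrite -subr_eq0 -dgmx_ad A0 /dgmx; case: insubP => [j _ _|_] //.
  by rewrite !linear0.
have nc2 : comm_diff x 2 != 0 by apply: ncx.1; rewrite (ltnW k3).
rewrite comm_diffE in nc2.
by apply: (trcomm_centralizer _ _ nc2); rewrite ?cA// adj3_sl// det_gmx.
Qed.

(* [Q] inverts [ad_tuple x] on the kernel of [dtheta x], which has dimension
   [9 k - (9 k - 8) = 8], the dimension of the image of [ad_tuple x]. *)
Lemma slice_decomposition (x : E) : (3 <= k)%N -> sl_tuple x -> noncritical x ->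
  exists (r : 'rV[C]_(k + (8 * k - 8)) -> E) (Q : E -> 'M[C]_3),
  [/\ linear r, linear Q, cancel r (dtheta x) &
    forall z, ad_tuple x (Q z) = z - r (dtheta x z)].
Proof.
move=> k3 slx ncx; have [r lr rK] := dtheta_onto k3 slx ncx.
have [M HM] := linear_mulmx (dtheta_linear x).
have [N HN] : exists N : 'M[C]_(3 * 3, k * (3 * 3)),
    forall A, mxvec (ad_tuple x A) = mxvec A *m N.
  apply: linear_mulmx => c A B.
  by rewrite ad_tuple_linear linearP.
have NM : N *m M = 0.
  apply/row_matrixP => i; rewrite row0 rowE mulmxA -[delta_mx 0 i]vec_mxK -HN -HM.
  exact: dtheta_ad.
have rM : row_full M.
  apply/row_fullP; exists (\matrix_i mxvec (r (delta_mx 0 i))).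
  by apply/row_matrixP => i; rewrite row_mul rowK -HM rK row1.
(* Only scalar matrices commute with the tuple, so [ad_tuple x] has a kernel of dimension at most 1
   in a space of dimension 9. *)
have rN : (8 <= \rank N)%N.
  have : (kermx N <= (mxvec 1%:M : 'rV[C]_(3 * 3)))%MS.
    apply/row_subP => i; set u := row i _.
    have uN : u *m N = 0 by apply/sub_kermxP; exact: row_sub.
    have [|c uc] := @commute_scalar x (vec_mx u) k3 slx ncx.
      by apply: (can_inj mxvecK); rewrite HN vec_mxK uN linear0.
    by apply/sub_rVP; exists c; rewrite -linearZ /= scalemx1 -uc vec_mxK.
  move=> /mxrankS; rewrite mxrank_ker => H.
  have := leq_trans H (rank_leq_row _); lia.
have kN : (kermx M <= N)%MS.
  have sNk : (N <= kermx M)%MS by apply/sub_kermxP.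
  rewrite -(mxrank_leqif_sup sNk).2 eqn_leq mxrankS//= mxrank_ker (eqP rM).
  by apply: leq_trans rN; lia.
(* [P] is the projection onto the kernel of [dtheta x] along the image of [r]; factoring it through
   [N] yields [Q]. *)
have [P HP] : exists P, forall z, mxvec (z - r (dtheta x z)) = mxvec z *m P.
  apply: linear_mulmx => c z z'; rewrite dtheta_linear lr opprD addrACA -scalerBr.
  exact: linearP.
have PM : P *m M = 0.
  apply/row_matrixP => i; rewrite row0 rowE mulmxA -[delta_mx 0 i]vec_mxK -HP -HM.
  set z := vec_mx _; have -> : z - r (dtheta x z) = -1 *: r (dtheta x z) + z.
    by rewrite scaleN1r addrC.
  by rewrite dtheta_linear rK scaleN1r addNr.
have /submxP[D PD] : (P <= N)%MS by apply: submx_trans kN; apply/sub_kermxP.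
exists r, (fun z => vec_mx (mxvec z *m D)); split=> //.
  by move=> c z z'; rewrite linearP /= mulmxDl -scalemxAl linearP.
by move=> z; apply: (can_inj mxvecK); rewrite HN vec_mxK HP PD mulmxA.
Qed.
End Slice.

Section WordDifferential.
Variables (R : realType) (k : nat).
Local Notation C := (Cplx R).
Local Notation E := 'M[C]_(k, 3 * 3).
Variable a : E.

Lemma strict_diff_gmx i : strict_diff (fun x : E => gmx x i) a (fun h => dgmx h i).
Proof.
rewrite /gmx /dgmx; case: insubP => [j _ _|_]; last exact: strict_diff_cst.
by apply: strict_diff_linear => c x y; rewrite !linearP.
Qed.

Lemma strict_diff_adj3 (F L : E -> 'M[C]_3) : strict_diff F a L ->
  strict_diff (fun x => adj3 (F x)) a (fun h => dadj3 (F a) (L h)).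
Proof.
move=> sF; have sij i j := strict_diff_entry i j sF.
have s2 : strict_diff (fun x => tr2 (F x)) a
    (fun h => \tr (F a) * \tr (L h) - \tr (F a *m L h)).
  rewrite /tr2; apply: (strict_diff_eq (frefl _)); last first.
    apply: strict_diffD; first apply: strict_diffD; apply: strict_diffB;
      apply: strict_diffM; exact: sij.
  by move=> h /=; rewrite !tr3E !mulmx3E; ring.
apply: strict_diffD; last first.
  apply: strict_diff_eq (strict_diffZ s2 (strict_diff_cst _ 1%:M)) => x /=.
    by rewrite scalemx1.
  by rewrite scaler0 addr0 scalemx1.
apply: (strict_diff_eq (frefl _)); last first.
  apply: strict_diffB; first exact: (strict_diff_mulmx sF sF).
  exact: (strict_diffZ (strict_diff_tr sF) sF).
by move=> h /=; rewrite opprD addrA.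
Qed.

Lemma strict_diff_word w : strict_diff (fun x : E => word_mx x w) a (fun h => dword_mx a h w).
Proof.
elim: w => [|l w IH] /=; first exact: strict_diff_cst.
apply: strict_diff_mulmx IH; rewrite /letter /dletter.
case: (l.2); first exact: strict_diff_adj3 (strict_diff_gmx _).
exact: strict_diff_gmx.
Qed.

Lemma strict_diff_tr_word w :
  strict_diff (fun x : E => tr_word x w) a (fun h => \tr (dword_mx a h w)).
Proof. exact: strict_diff_tr (strict_diff_word w). Qed.

Lemma strict_diff_det (F L : E -> 'M[C]_3) : strict_diff F a L ->
  strict_diff (fun x => \det (F x)) a (fun h => \tr (adj3 (F a) * L h)).
Proof.
move=> sF; have := strict_diff_entry 0 0 (strict_diff_mulmx sF (strict_diff_adj3 sF)).
apply: strict_diff_eq => x /=; first by rewrite mulmx_adj3 mxE.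
by rewrite addrC mulmx_dadj3 mxE.
Qed.

Definition theta (x : E) : 'rV[C]_(k + (8 * k - 8)) :=
  row_mx (\row_(i < k) \det (gmx x i.+1))
    (\row_(j < 8 * k - 8) tr_word x (nth [::] (trace_seq k) j)).

Lemma strict_diff_theta : strict_diff theta a (dtheta a).
Proof.
apply: strict_diff_mx => i j; rewrite ord1 /theta /dtheta; case: (splitP j) => j' jj'.
  have -> : j = lshift _ j' by exact/val_inj.
  apply: strict_diff_eq (strict_diff_det (strict_diff_gmx j'.+1)) => x.
    by rewrite row_mxEl mxE.
  by rewrite row_mxEl mxE.
have -> : j = rshift _ j' by exact/val_inj.
apply: strict_diff_eq (strict_diff_tr_word (nth [::] (trace_seq k) j')) => x.
  by rewrite row_mxEr mxE.
by rewrite row_mxEr mxE.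
Qed.
End WordDifferential.

(** * Local sections of the trace map *)

Section NearIdentity.
Variables (R : realType) (p q : nat).
Local Notation C := (Cplx R).
Local Notation E := 'M[C]_(p, q).

(** [near_identity] forces [|G y - G x| >= |y - x| / 2], whereas along a direction killed by [L] the
    increment would be at most a quarter of [|y - x|]. This serves to differentiate the local
    section at every point, not only at the centre. *)
Lemma near_identity_diff_inj (G : E -> E) a r x L u : near_identity G a r ->
  `|x - a| < r -> strict_diff G x L -> L u = 0 -> u = 0.
Proof.
move=> nG xa [lL HL] Lu0; have h4 : 0 < 4^-1 :> C by rewrite invr_gt0 ltr0n.
have [N xN HN] := HL _ h4.
have [u0|u0] := eqVneq u 0; first by [].
have : nbhs x (N `&` ball a r).
  apply: filterI => //; have xar : 0 < r - `|x - a| by rewrite subr_gt0.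
  apply/nbhs_ballP; exists (r - `|x - a|) => // y; rewrite -!ball_normE /= => xy.
  by rewrite -(subrKA x) (le_lt_trans (ler_normD _ _))// -ltrBrDl (distrC a).
move=> /nbhs_ballP[s s0 sN].
have un0 : 0 < `|u| by rewrite normr_gt0.
pose t := s / (2 * `|u|).
have t0 : 0 < t by rewrite divr_gt0// mulr_gt0// ltr0n.
have [Ny ya] : (N `&` ball a r) (x + t *: u).
  apply: sN; rewrite -ball_normE /= opprD addrA subrr sub0r normrN normrZ gtr0_norm//.
  rewrite /t invfM mulrA mulfVK ?gt_eqF// ltr_pdivrMr ?ltr0n// mulr_natr mulr2n.
  by rewrite ltrDl.
move: ya; rewrite -ball_normE /= distrC => ya.
have := HN _ _ Ny (nbhs_singleton xN).
have LZ : L (t *: u) = 0 by rewrite (linear_morphZ _ _ lL) Lu0 scaler0.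
have := near_identity_inj nG ya xa.
rewrite [x + _ - x]addrC addKr LZ subr0 => H1 H2.
suff : `|t *: u| <= 2^-1 * `|t *: u|.
  rewrite ler_pMl ?normr_gt0 ?scaler_eq0 ?negb_or ?gt_eqF//.
    by rewrite invf_ge1 ?ltr0n// lern1.
  by rewrite invr_gt0 mulr_gt0 ?ltr0n.
apply: le_trans H1 _; apply: le_trans (ler_wpM2l _ H2) _; rewrite ?ler0n//.
rewrite mulrA le_eqVlt; apply/orP; left; apply/eqP; congr (_ * _).
by field.
Qed.

Lemma strict_diff_neq0 (f l : E -> C) a : strict_diff f a l -> f a != 0 ->
  nbhs a [set x | f x != 0].
Proof.
move=> sf fa; have fa0 : 0 < `|f a| / 2 by rewrite divr_gt0 ?normr_gt0 ?ltr0n.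
have [N aN HN] := strict_diff_near sf fa0.
apply: filterS aN => x /HN /= fx; apply/negP => /eqP fx0; move: fx.
rewrite fx0 sub0r normrN ler_pdivlMr ?ltr0n// mulr_natr mulr2n gerDl.
by rewrite normr_le0 (negPf fa).
Qed.
End NearIdentity.

Section LocalSection.
Variables (R : realType) (k : nat).
Local Notation C := (Cplx R).
Local Notation E := 'M[C]_(k, 3 * 3).

Lemma nbhs_noncritical (x : E) : noncritical x -> nbhs x (@noncritical C k).
Proof.
move=> [nc nd].
have sd w := strict_diff_tr_word x w.
have nc' : \forall y \near x, forall i : 'I_k.+1, (2 <= i)%N -> comm_diff y i != 0.
  apply: (@filter_forall _ _ _ _ (nbhs_filter x)) => i.
  case: (leqP 2 i) => i2; last by apply: nearW.
  have ci : comm_diff x i != 0 by apply: nc; rewrite i2 -ltnS ltn_ord.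
  by apply: filterS (strict_diff_neq0 (strict_diffB (sd _) (sd _)) ci).
have nd' : \forall y \near x, forall i : 'I_k.+1, (3 <= i)%N -> delta_tuple y i != 0.
  apply: (@filter_forall _ _ _ _ (nbhs_filter x)) => i.
  case: (leqP 3 i) => i3; last by apply: nearW.
  have ci : delta_tuple x i != 0 by apply: nd; rewrite i3 -ltnS ltn_ord.
  apply: filterS (strict_diff_neq0 (strict_diffB
    (strict_diffM (strict_diffB (sd _) (sd _)) (strict_diffB (sd _) (sd _)))
    (strict_diffM (strict_diffB (sd _) (sd _)) (strict_diffB (sd _) (sd _)))) ci).
  by [].
near=> y; split=> i /andP[i2 ik].
  by have := near nc' y; move/(_ _)/(_ (Ordinal (ik : (i < k.+1)%N)) i2); apply.
by have := near nd' y; move/(_ _)/(_ (Ordinal (ik : (i < k.+1)%N)) i2); apply.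
Unshelve. all: by end_near. Qed.

Definition traces (x : E) : 'rV[C]_(8 * k - 8) :=
  \row_j tr_word x (nth [::] (trace_seq k) j).

Lemma thetaE (x : E) : theta x = row_mx (\row_i \det (gmx x i.+1)) (traces x).
Proof. by []. Qed.

Lemma gmx_row (x : E) (i : 'I_k) : gmx x i.+1 = vec_mx (row i x).
Proof. by rewrite /gmx /= valK. Qed.

Lemma theta_sl (x : E) : sl_tuple x -> theta x = row_mx (const_mx 1) (traces x).
Proof.
move=> slx; rewrite thetaE; congr row_mx; apply/rowP => i.
by rewrite !mxE gmx_row slx.
Qed.

Lemma sl_of_theta (x : E) v : theta x = row_mx (const_mx 1) v ->
  sl_tuple x /\ traces x = v.
Proof.
rewrite thetaE => /eq_row_mx[/rowP d ->]; split=> // i.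
by have := d i; rewrite !mxE gmx_row.
Qed.

Section AtPoint.
Variables (x0 : E).
Hypotheses (sl0 : sl_tuple x0) (nc0 : noncritical x0).
Variables (r : 'rV[C]_(k + (8 * k - 8)) -> E) (Q : E -> 'M[C]_3).
Hypotheses (lr : linear r) (lQ : linear Q) (rK : cancel r (dtheta x0)).
Hypothesis adQ : forall z, ad_tuple x0 (Q z) = z - r (dtheta x0 z).

Let dtheta0 := dtheta_linear x0.
Lemma strict_diff_shift (W : normedModType C) (l : E -> W) a : linear l ->
  strict_diff (fun x => l (x - x0)) a l.
Proof.
move=> ll; apply: strict_diff_eq (strict_diffB (strict_diff_linear a ll)
  (strict_diff_cst a (l x0))) => x /=; last by rewrite subr0.
by rewrite linear_morphB.
Qed.

(* [straighten] has identity differential at [x0]; it transports [theta] to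
   [dtheta x0] and fixes the component along [ker (dtheta x0)], so that
   [straighten x = zeta v] amounts to [theta x = (1, v)] on the slice. *)
Definition straighten (x : E) : E := x + r (theta x - theta x0 - dtheta x0 (x - x0)).

Lemma strict_diff_straighten a :
  strict_diff straighten a (fun h => h + r (dtheta a h - dtheta x0 h)).
Proof.
apply: strict_diffD; first by apply: strict_diff_linear => c x y.
apply: (strict_diff_postmx lr).
apply: strict_diffB (strict_diff_shift _ dtheta0).
apply: (strict_diff_eq (frefl _) _
  (strict_diffB (strict_diff_theta a) (strict_diff_cst a (theta x0)))) => h /=.
exact: subr0.
Qed.

Lemma straighten0 : straighten x0 = x0.
Proof.
by rewrite /straighten !subrr sub0r (linear_morph0 dtheta0) oppr0 (linear_morph0 lr) addr0.
Qed.

(** The determinant coordinates are held at 1, so that the solutions of [straighten x = zeta v] have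
    their matrices in SL_3. *)
Definition zeta (v : 'rV[C]_(8 * k - 8)) : E :=
  x0 + r (row_mx (const_mx 1) v - theta x0).

Lemma straighten_theta x v : straighten x = zeta v -> theta x = row_mx (const_mx 1) v.
Proof.
move=> /(congr1 (fun z => dtheta x0 (z - x0))); rewrite /straighten /zeta.
rewrite addrAC [x0 + _ - x0]addrC addKr rK.
rewrite (linear_morphD dtheta0) rK [dtheta x0 _ + _]addrC subrK => /(congr1 (+%R^~ (theta x0))).
by rewrite !subrK.
Qed.

Lemma zeta_traces (x : E) : sl_tuple x ->
  zeta (traces x) = x0 + r (theta x - theta x0).
Proof. by move=> slx; rewrite /zeta -theta_sl. Qed.

Lemma zeta0 : zeta (traces x0) = x0.
Proof. by rewrite zeta_traces// subrr (linear_morph0 lr) addr0. Qed.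

Lemma strict_diff_zeta v : strict_diff zeta v (fun w => r (row_mx 0 w)).
Proof.
have lz : linear (fun w : 'rV[C]_(8 * k - 8) => r (row_mx 0 w)).
  by move=> c u w; rewrite -lr scale_row_mx add_row_mx scaler0 addr0.
apply: (strict_diff_eq _ _ (strict_diffD (strict_diff_cst v
  (x0 + r (row_mx (const_mx 1) 0 - theta x0))) (strict_diff_linear v lz))) => w /=.
  by rewrite /zeta -addrA -(linear_morphD lr) addrAC add_row_mx addr0 add0r.
exact: add0r.
Qed.

(** [S v] is the preimage of [zeta v] under [straighten]. In the last clause [x] lies on the slice,
    where [straighten x] reduces to [x0 + r (theta x - theta x0)], that is, to [zeta (traces x)];
    injectivity gives [S (traces x) = x]. *)
Lemma local_section : exists (S : 'rV[C]_(8 * k - 8) -> E) (V : set 'rV[C]_(8 * k - 8))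
    (rho : C),
  [/\ 0 < rho, open V, V (traces x0),
     forall v, V v -> [/\ sl_tuple (S v), noncritical (S v), traces (S v) = v
                        & differentiable S v] &
     forall x, `|x - x0| < rho -> sl_tuple x ->
       V (traces x) -> r (dtheta x0 (x - x0)) = x - x0 -> S (traces x) = x].
Proof.
have sG : strict_diff straighten x0 id.
  apply: (strict_diff_eq (frefl _) _ (strict_diff_straighten x0)) => h /=.
  by rewrite subrr (linear_morph0 lr) addr0.
have [rho rho0 [nG rhonc]] := strict_diff_near_identity sG (nbhs_noncritical nc0).
have sec v : `|zeta v - x0| < rho / 4 ->
    exists2 x, `|x - x0| < rho & straighten x = zeta v.
  by move=> H; apply: near_identity_onto rho0 nG _; rewrite straighten0.
pose V := [set v | `|zeta v - x0| < rho / 4].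
pose S v := if pselect (V v) is left Vv then s2val (cid2 (sec v Vv)) else x0.
have HS v : V v -> `|S v - x0| < rho /\ straighten (S v) = zeta v.
  rewrite /S; case: pselect => // Vv _; split.
    exact: (s2valP (cid2 (sec v Vv))).
  exact: (s2valP' (cid2 (sec v Vv))).
have oV : open V.
  rewrite (_ : V = zeta @^-1` ball x0 (rho / 4)); last first.
    by apply/seteqP; split=> v; rewrite /V /= -ball_normE /= distrC.
  apply: open_comp; last exact: ball_open.
  move=> v _; exact: differentiable_continuous (strict_diff_differentiable (strict_diff_zeta v)).
exists S, V, rho; split; [exact: rho0|exact: oV| | |].
- by rewrite /V /= zeta0 subrr normr0 divr_gt0// ltr0n.
- move=> v Vv; have [Sv GS] := HS v Vv.
  have [slS tS] := sl_of_theta (straighten_theta GS).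
  split; [exact: slS|exact: rhonc|exact: tS|].
  have VV : nbhs v V by exact: open_nbhs_nbhs.
  have [|||l sS] := strict_diff_inverse VV _ _ (strict_diff_straighten (S v)) _
    (strict_diff_zeta v).
  + move=> w w' Vw Vw'; have [Sw <-] := HS w Vw; have [Sw' <-] := HS w' Vw'.
    exact: near_identity_inj nG Sw Sw'.
  + by move=> w /HS[].
  + by move=> u; exact: near_identity_diff_inj nG Sv (strict_diff_straighten (S v)).
  exact: strict_diff_differentiable sS.
move=> x xr slx Vx Hr; have [Sv GS] := HS _ Vx.
apply/eqP; rewrite -subr_eq0 -normr_le0; apply: le_trans (near_identity_inj nG Sv xr) _.
rewrite GS zeta_traces// /straighten (linear_morphB lr (theta x - _)) Hr.
by rewrite addrA addrAC opprB addrCA subrr addr0 subrr normr0 mulr0.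
Qed.

Let Dr z := r (dtheta x0 z).

Let lDr : linear Dr.
Proof. by move=> c x y; rewrite /Dr dtheta0 lr. Qed.

(* [spread] conjugates the points of the slice; its differential at [x0] is
   [z |-> ad_tuple x0 (Q z) + r (dtheta x0 z) = z]. *)
Definition conjugator (z : E) : 'M[C]_3 := 1 + Q (z - x0).
Definition slice_point (z : E) : E := x0 + Dr (z - x0).
Definition spread (z : E) : E :=
  conj_tuple (conjugator z) ((\det (conjugator z))^-1 *: adj3 (conjugator z))
    (slice_point z).

Lemma conjugator0 : conjugator x0 = 1.
Proof. by rewrite /conjugator subrr (linear_morph0 lQ) addr0. Qed.

Lemma slice_point0 : slice_point x0 = x0.
Proof. by rewrite /slice_point subrr (linear_morph0 lDr) addr0. Qed.

Lemma strict_diff_conjugator : strict_diff conjugator x0 Q.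
Proof.
apply: (strict_diff_eq (frefl _) _ (strict_diffD (strict_diff_cst x0 (1%:M : 'M[C]_3))
  (strict_diff_shift _ lQ))) => z /=.
exact: add0r.
Qed.

Lemma strict_diff_slice_point : strict_diff slice_point x0 Dr.
Proof.
apply: (strict_diff_eq (frefl _) _ (strict_diffD (strict_diff_cst x0 x0)
  (strict_diff_shift _ lDr))) => z /=.
exact: add0r.
Qed.

Lemma adj31 : adj3 1 = 1 :> 'M[C]_3.
Proof. by have := adj3_sl (det1 C 3); rewrite mul1r. Qed.

Lemma strict_diff_conjugatorV : strict_diff
  (fun z => (\det (conjugator z))^-1 *: adj3 (conjugator z)) x0 (fun z => - Q z).
Proof.
have d1 : \det (conjugator x0) = 1 by rewrite conjugator0 det1.
have sV := @strict_diffV _ _ _ x0 (fun z => \det (conjugator z)) _ d1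
  (strict_diff_det strict_diff_conjugator).
have := strict_diffZ sV
  (strict_diff_adj3 strict_diff_conjugator).
apply: strict_diff_eq => z //=.
rewrite conjugator0 det1 invr1 scale1r dadj3_sl ?det1// adj31 !mul1r mulr1.
by rewrite scaleNr addrA addNr add0r.
Qed.

Lemma strict_diff_spread : strict_diff spread x0 id.
Proof.
apply: strict_diff_mx => i s.
have sX : strict_diff (fun z => vec_mx (row i (slice_point z)) : 'M[C]_3) x0
    (fun h => vec_mx (row i (Dr h))).
  apply: (@strict_diff_postmx _ _ _ _ _ _ _ _ _ (fun z => vec_mx (row i z)))
    strict_diff_slice_point.
  by move=> c x y; rewrite !linearP.
have sM := strict_diff_mulmx (strict_diff_mulmx strict_diff_conjugator sX)
  strict_diff_conjugatorV.
have lm : linear (fun M : 'M[C]_3 => mxvec M) by move=> c x y; rewrite linearP.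
have := strict_diff_entry 0 s (strict_diff_postmx lm sM).
apply: strict_diff_eq => z /=; first by rewrite /spread /conj_tuple mxE.
rewrite conjugator0 slice_point0 det1 invr1 scale1r adj31 mulmx1 !mul1mx.
have : ad_tuple x0 (Q z) + Dr z = z by rewrite adQ subrK.
move=> /(congr1 (fun M : E => row i M 0 s)); rewrite linearD /= mxE [RHS]mxE => <-.
rewrite /ad_tuple rowK mulmxN addrAC.
by rewrite [mxvec (_ + vec_mx _)]linearD /= mxE vec_mxK.
Qed.

Lemma spread0 : spread x0 = x0.
Proof.
rewrite /spread conjugator0 slice_point0 det1 invr1 scale1r adj31.
by apply/row_matrixP => i; rewrite rowK mul1mx mulmx1 vec_mxK.
Qed.

(** Points near [x0] are values of [spread] by [near_identity_onto]. The last condition says that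
    [x - x0] lies in the image of [r], to which [slice_point] is confined. *)
Lemma local_slice rho : 0 < rho -> nbhs x0 [set y | exists A B x,
  [/\ A * B = 1, y = conj_tuple A B x, `|x - x0| < rho &
    r (dtheta x0 (x - x0)) = x - x0]].
Proof.
move=> rho0.
have d0 : \det (conjugator x0) != 0 by rewrite conjugator0 det1 oner_eq0.
have rho2 : 0 < rho / 2 by rewrite divr_gt0// ltr0n.
have [N xN HN] := strict_diff_near strict_diff_slice_point rho2.
have xN' : nbhs x0 ([set z | \det (conjugator z) != 0] `&` N).
  by apply: filterI xN; exact: strict_diff_neq0 (strict_diff_det strict_diff_conjugator) d0.
have [e e0 [nG eN]] := strict_diff_near_identity strict_diff_spread xN'.
apply/nbhs_ballP; exists (e / 4); first by rewrite /= divr_gt0// ltr0n.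
move=> y; rewrite -ball_normE /= distrC -{1}spread0 => /(near_identity_onto e0 nG)[z ze <-].
have [/= dz /HN sz] := eN z ze.
exists (conjugator z), ((\det (conjugator z))^-1 *: adj3 (conjugator z)), (slice_point z).
split=> //.
- rewrite mul_scale [_ * _](mulmx_adj3 (conjugator z)).
  by rewrite scale_scalar_mx mulVf.
- rewrite slice_point0 in sz; apply: le_lt_trans sz _.
  by rewrite ltr_pdivrMr ?ltr0n// mulr_natr mulr2n ltrDl.
- by rewrite /slice_point [x0 + _]addrC addrK /Dr rK.
Qed.

End AtPoint.
End LocalSection.

Section LocalChart.
Variables (R : realType) (k : nat).
Local Notation C := (Cplx R).
Local Notation E := 'M[C]_(k, 3 * 3).

Lemma conj_tupleK (K : fieldType) (A B : 'M[K]_3) (x : 'M[K]_(k, 3 * 3)) :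
  A * B = 1 -> conj_tuple B A (conj_tuple A B x) = x.
Proof.
move=> AB; have BA : B *m A = 1%:M by apply: mulmx1C.
apply/row_matrixP => i; rewrite !rowK mxvecK -!mulmxA [_ *m A]BA.
by rewrite mulmx1 [B *m _]mulmxA BA mul1mx vec_mxK.
Qed.

Lemma strict_diff_traces (a : E) :
  strict_diff (@traces R k) a (fun h => rsubmx (dtheta a h)).
Proof.
have := strict_diff_postmx (@linearP _ _ _ _ (@rsubmx C 1 k (8 * k - 8)))
  (strict_diff_theta a).
by apply: strict_diff_eq => x //=; rewrite thetaE row_mxKr.
Qed.

Lemma nbhs_traces (a : E) (V : set 'rV[C]_(8 * k - 8)) :
  open V -> V (traces a) -> nbhs a (@traces R k @^-1` V).
Proof.
move=> oV Va; apply: (differentiable_continuous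
  (strict_diff_differentiable (strict_diff_traces a))).
exact: open_nbhs_nbhs.
Qed.

(** A tuple [y] near [x0] is conjugate to some [x] on the slice, with the same traces, and [S]
    recovers [x] from these. *)
Lemma local_chart (x0 : E) : (3 <= k)%N -> sl_tuple x0 -> noncritical x0 ->
  exists (S : 'rV[C]_(8 * k - 8) -> E) (V : set 'rV[C]_(8 * k - 8)),
  [/\ open V, V (traces x0),
     forall v, V v -> [/\ sl_tuple (S v), noncritical (S v), traces (S v) = v
                        & differentiable S v] &
     nbhs x0 [set y | V (traces y) /\ (sl_tuple y ->
       exists A B, A * B = 1 /\ y = conj_tuple A B (S (traces y)))]].
Proof.
move=> k3 sl0 nc0.
have [r [Q [lr lQ rK adQ]]] := slice_decomposition k3 sl0 nc0.
have [S [V [rho [rho0 oV V0 HS HSx]]]] := local_section sl0 nc0 lr rK.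
exists S, V; split=> //.
have slice := local_slice lr lQ rK adQ rho0.
apply: filterS2 slice (nbhs_traces oV V0) => y [A [B [x [AB yx xr Hr]]]] Vy.
split=> [|sly]; [exact: Vy|exists A, B; split; first exact: AB].
have slx : sl_tuple x.
  by rewrite -(conj_tupleK x AB) -yx; apply: sl_tuple_conj sly; exact: mulmx1C.
have tyx : traces y = traces x.
  by apply/rowP => j; rewrite !mxE yx tr_word_conj.
by rewrite tyx HSx// -tyx.
Qed.
End LocalChart.

(** * The character manifold *)

Section Representations.
Variables (R : realType) (k : nat) (F : groupType) (gam : k.-tuple F).
Local Notation C := (Cplx R).
Local Notation E := 'M[C]_(k, 3 * 3).
Local Notation hom := {multiplicative F -> SL3 C}.
Implicit Types (rho : hom) (sigma : goodHom R gam) (x : E).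
Local Notation coord sigma := (coords gam (ghom sigma)).

Lemma hom1 rho : rho 1%g = 1%g.
Proof. by apply: (mulIg (rho 1%g)); rewrite -gmulfM !mul1g. Qed.

Lemma homV rho y : rho y^-1%g = (rho y)^-1%g.
Proof. by apply: (mulIg (rho y)); rewrite -gmulfM !mulVg hom1. Qed.

Lemma slmxM (A B : SL3 C) : slmx (A * B)%g = slmx A * slmx B.
Proof. by []. Qed.

Lemma slmxV (A : SL3 C) : slmx A^-1%g = adj3 (slmx A).
Proof. exact: invmx_adj3 (det_slmx A). Qed.

Lemma gmx_coords rho i : gmx (coords gam rho) i = slmx (rho (gen gam i)).
Proof.
rewrite /gmx /gen; case: insubP => [j _ <-|ki].
  by rewrite rowK mxvecK -tnth_nth.
by rewrite nth_default ?hom1// size_tuple leqNgt.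
Qed.

Lemma sl_tuple_coords rho : sl_tuple (coords gam rho).
Proof. by move=> j; rewrite rowK mxvecK det_slmx. Qed.

Definition gletter (l : nat * bool) : F := if l.2 then (gen gam l.1)^-1%g else gen gam l.1.

(** The last letter is not multiplied by 1, so that the words match those of [trace_words]
    literally. *)
Fixpoint gword (w : seq (nat * bool)) : F :=
  if w is l :: w' then if w' is [::] then gletter l else (gletter l * gword w')%g
  else 1%g.

Lemma word_coords rho w : word_mx (coords gam rho) w = slmx (rho (gword w)).
Proof.
have Hl l : letter (coords gam rho) l = slmx (rho (gletter l)).
  by rewrite /letter /gletter gmx_coords; case: (l.2) => //; rewrite homV slmxV.
elim: w => [|l w IH] /=; first by rewrite hom1.
rewrite IH Hl; case: w {IH} => [|l' w] /=; first by rewrite hom1 mulr1.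
by rewrite -slmxM -gmulfM.
Qed.

Lemma tau_word w sigma : tau (gword w) (cls sigma) = tr_word (coord sigma) w.
Proof. by rewrite tau_cls /tr_word word_coords. Qed.

Lemma trace_wordsE : trace_words gam = [seq gword w | w <- trace_seq k].
Proof.
rewrite /trace_words /trace_seq !map_cat !map_flatten -!map_comp.
by do !congr (_ ++ _); congr flatten; apply: eq_map => i.
Qed.

Lemma trace_map_cls sigma : (3 <= k)%N -> trace_map (cls sigma) = traces (coord sigma).
Proof.
move=> k3; apply/rowP => j; rewrite !mxE trace_wordsE (nth_map [::]) ?size_trace_seq//.
exact: tau_word.
Qed.

Lemma comm_diff_cls sigma i :
  tau (gen gam 1 * gen gam i * (gen gam 1)^-1 * (gen gam i)^-1)%g (cls sigma)
  - tau (gen gam i * gen gam 1 * (gen gam i)^-1 * (gen gam 1)^-1)%g (cls sigma)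
  = comm_diff (coord sigma) i.
Proof. by rewrite /comm_diff -!tau_word /= /gletter /= !mulgA. Qed.

Lemma Delta1_2_cls sigma i :
  @Delta1_2 R k F gam i (cls sigma) = delta_tuple (coord sigma) i.
Proof. by rewrite /Delta1_2 /delta_tuple -!tau_word /= /gletter /= !mulgA. Qed.

Lemma crit_cls sigma : ~ crit (cls sigma) <-> noncritical (coord sigma).
Proof.
split=> [nc|[nc nd] [[i ik]|[i ik]]]; first split=> i ik.
- apply/negP => /eqP; rewrite -comm_diff_cls => /eqP; rewrite subr_eq0 => /eqP E0.
  by apply: nc; left; exists i.
- apply/negP => /eqP; rewrite -Delta1_2_cls => E0.
  by apply: nc; right; exists i.
- move=> /= E0; move: (nc i ik); rewrite -comm_diff_cls E0 subrr eqxx //.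
- move=> /= E0; move: (nd i ik); rewrite -Delta1_2_cls E0 eqxx //.
Qed.

Section Free.
Hypothesis free_gam : free_basis gam.

Lemma free_hom_inj (H : groupType) (f g : {multiplicative F -> H}) :
  (forall i, f (tnth gam i) = g (tnth gam i)) -> f = g.
Proof.
move=> fg; have [h [_ uh]] := free_gam (map_tuple f gam).
rewrite -(uh f)// -(uh g)//; apply/eq_from_tnth => i.
by rewrite !tnth_map fg.
Qed.

Lemma coords_surj x : sl_tuple x -> exists rho : hom, coords gam rho = x.
Proof.
move=> slx; have dx j : \det (vec_mx (row j x) : 'M[C]_3) == 1 by rewrite slx.
have [f [Hf _]] := free_gam [tuple MkSL3 (dx j) | j < k].
exists f; apply/row_matrixP => j; rewrite rowK.
have := congr1 (fun t => tnth t j) Hf; rewrite tnth_map tnth_mktuple => ->.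
by rewrite /= vec_mxK.
Qed.

(** Every member of a flag stable under the image is zero or everything, so the stabilizer of the
    flag is the whole group. *)
Lemma good_noncritical rho : (2 <= k)%N -> noncritical (coords gam rho) ->
  @good R k F gam rho.
Proof.
move=> k2 [nc _]; have := nc 2%N; rewrite /= k2 => /(_ isT).
rewrite comm_diffE !gmx_coords; set A := slmx (rho _); set B := slmx (rho _) => nAB.
have AA : A * adj3 A = 1 by rewrite adj3_sl// det_slmx.
have BB : B * adj3 B = 1 by rewrite adj3_sl// det_slmx.
split.
  move=> P [s sorts ->] Pn sub; apply: Pn; apply/seteqP; split=> // D _ U Us.
  have st y : stablemx U (slmx (rho y)) by apply: (sub (rho y)) => //; exists y.
  have [->|fU] := trcomm_irr AA BB nAB (st _) (st _); first by rewrite mul0mx sub0mx.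
  by rewrite submx_full.
apply/seteqP; split=> Z /= HZ => [|y]; last exact: HZ.
have [c Zc] : exists c, slmx Z = c%:M.
  apply: (trcomm_centralizer AA BB nAB).
    exact: (congr1 (@slmx C) (HZ (gen gam 1))).
  exact: (congr1 (@slmx C) (HZ (gen gam 2))).
by move=> D; apply/val_inj; rewrite /= Zc scalar_mxC.
Qed.

Lemma goodHom_exists x : (2 <= k)%N -> sl_tuple x -> noncritical x ->
  exists sigma, coord sigma = x.
Proof.
move=> k2 slx ncx; have [rho rx] := coords_surj slx.
have gr : @good R k F gam rho.
  by apply: (good_noncritical k2); rewrite rx.
by exists (SigSub (mem_set gr)).
Qed.

Lemma cls_conj sigma1 sigma2 A B : A * B = 1 ->
  coord sigma2 = conj_tuple A B (coord sigma1) -> cls sigma1 = cls sigma2.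
Proof.
(* [A] is only invertible; a cube root of the inverse of its determinant rescales it into SL_3
   without changing the conjugation. *)
move=> AB E12; pose c : C := 3.-root (\det A)^-1.
have dA0 : \det A != 0.
  apply: contraTneq (oner_neq0 C) => dA.
  by rewrite -(det1 C 3) -[1%:M]AB det_mulmx dA mul0r eqxx.
have c3 : c ^+ 3 = (\det A)^-1 by rewrite rootCK.
have c0 : c != 0.
  by apply: contraTneq (invr_neq0 dA0) => c0; rewrite -c3 c0 expr0n eqxx.
have dS : \det (c *: A) == 1 by rewrite detZ c3 mulVf.
pose S : SL3 C := MkSL3 dS.
have SV : slmx S^-1%g = c^-1 *: B.
  have E1 : slmx S * (c^-1 *: B) = 1.
    by rewrite mul_scale -scalerAl AB scalerA mulVf// scale1r.
  have SS : slmx S^-1%g * slmx S = 1 by rewrite -slmxM mulVg.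
  by rewrite -[LHS]mulr1 -E1 mulrA SS mul1r.
pose f y := (S * ghom sigma1 y * S^-1)%g.
have fM : {morph f : y z / (y * z)%g}.
  by move=> y z; rewrite /f gmulfM !mulgA mulgVK.
pose f' : {multiplicative F -> SL3 C} := HB.pack f (isMultiplicative.Build _ _ _ fM).
have E2 : ghom sigma2 = f'.
  apply: free_hom_inj => i; apply/val_inj.
  have := congr1 (row i) E12; rewrite !rowK mxvecK => /(can_inj mxvecK) /= ->.
  rewrite -[invmx _]/(slmx S^-1%g) SV -scalemxAl -scalemxAr -!scalemxAl scalerA.
  by rewrite mulVf// scale1r.
apply/eqmodP/asboolP; exists S => y.
by rewrite E2.
Qed.

Lemma conj_cls sigma1 sigma2 : cls sigma1 = cls sigma2 ->
  exists A B, A * B = 1 /\ coord sigma2 = conj_tuple A B (coord sigma1).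
Proof.
move=> /eqmodP/asboolP[A hA]; exists (slmx A), (slmx A^-1%g).
split; first by rewrite -slmxM mulgV.
by apply/row_matrixP => i; rewrite !rowK mxvecK hA.
Qed.

End Free.
End Representations.

Lemma differentiable_near_eq (R : realType) (V W : normedModType (Cplx R))
    (f g : V -> W) x :
  differentiable f x -> (\forall y \near x, f y = g y) -> differentiable g x.
Proof.
move=> df fg; apply: (differentiable_approx (diff_continuous df)) => e e0.
have [_ /eqaddoP/(_ e e0) H] := (diff_locallyP _ _).1 df.
exists [set y | `|f y - f x - 'd f x (y - x)| <= e * `|y - x| /\ f y = g y].
  apply: filterI => //; rewrite -[nbhs _ _]/(\near x, _) (near_shift 0) subr0.
  apply: filterS H => h /=; rewrite !fctE /= addrK opprD addrA.
  by [].
by move=> y [H1 <-]; rewrite -(nbhs_singleton fg).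
Qed.

Section Topology.
Variables (R : realType) (k : nat) (F : groupType) (gam : k.-tuple F).
Local Notation C := (Cplx R).
Local Notation E := 'M[C]_(k, 3 * 3).
Local Notation coord sigma := (coords gam (ghom sigma)).
Implicit Types (sigma : goodHom R gam).

Lemma near_goodHom sigma (N : set E) : nbhs (coord sigma) N ->
  \forall s \near sigma, N (coord s).
Proof.
move=> HN; have c1 : {for sigma, continuous (@ghom R k F gam : goodHom R gam -> Defs.Hom R gam)}.
  exact: initial_continuous.
have c2 : {for ghom sigma, continuous (coords gam : Defs.Hom R gam -> E)}.
  exact: initial_continuous.
exact: (c1 _ (c2 _ HN)).
Qed.

(** The topologies on representations and on good ones are both initial, so every neighbourhood
    comes from one in the space of matrices. *)
Lemma nbhs_goodHom sigma (M : set (goodHom R gam)) : nbhs sigma M ->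
  exists2 N, nbhs (coord sigma) N & forall s, N (coord s) -> M s.
Proof.
rewrite nbhsE => -[B [oB Bs] BM].
have [B' [B'' oB'' B'E] BE] := oB.
exists B''.
  apply: open_nbhs_nbhs; split=> //.
  by move: Bs; rewrite -BE /= -B'E.
move=> s sB; apply: BM; rewrite -BE /= -B'E; exact: sB.
Qed.

Lemma open_cls (U : set (Rstar R gam)) :
  (forall sigma, U (cls sigma) -> \forall s \near sigma, U (cls s)) -> open U.
Proof.
move=> HU; rewrite /open /= /quotient_open openE => sigma Us.
exact: HU.
Qed.

Lemma cls_continuous : continuous (@cls R k F gam).
Proof. exact: pi_continuous. Qed.

Lemma clsP (r : Rstar R gam) : exists sigma, r = cls sigma.
Proof. by exists (repr r); rewrite /cls reprK. Qed.
End Topology.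

Lemma conj_tuple_linear (K : fieldType) (k : nat) (A B : 'M[K]_3) :
  linear (conj_tuple A B : 'M[K]_(k, 3 * 3) -> _).
Proof.
move=> c y z; apply/row_matrixP => i; rewrite [RHS]linearP /= !rowK.
have -> : vec_mx (row i (c *: y + z)) = c *: vec_mx (row i y) + vec_mx (row i z)
    :> 'M[K]_3 by rewrite !linearP.
rewrite mulmxDr mulmxDl -scalemxAr -scalemxAl.
exact: linearP.
Qed.

Lemma conj_tuple_comp (K : fieldType) (k : nat) (A B A' B' : 'M[K]_3)
    (x : 'M[K]_(k, 3 * 3)) :
  conj_tuple A B (conj_tuple A' B' x) = conj_tuple (A * A') (B' * B) x.
Proof. by apply/row_matrixP => i; rewrite !rowK mxvecK !mulmxA. Qed.

(** * The chart at a noncritical class *)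

Section Chart.
Variables (R : realType) (k : nat) (F : groupType) (gam : k.-tuple F).
Local Notation C := (Cplx R).
Local Notation E := 'M[C]_(k, 3 * 3).
Local Notation coord sigma := (coords gam (ghom sigma)).
Implicit Types (sigma : goodHom R gam).
Hypotheses (k3 : (3 <= k)%N) (free_gam : free_basis gam).

Lemma traces_conj (A B : 'M[C]_3) (x : E) : A * B = 1 -> sl_tuple x ->
  traces (conj_tuple A B x) = traces x.
Proof. by move=> AB slx; apply/rowP => j; rewrite !mxE tr_word_conj. Qed.

Lemma noncritical_conj (A B : 'M[C]_3) (x : E) : A * B = 1 -> sl_tuple x ->
  noncritical (conj_tuple A B x) -> noncritical x.
Proof.
move=> AB slx [nc nd]; split=> i ik.
  by have := nc i ik; rewrite /comm_diff !tr_word_conj.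
by have := nd i ik; rewrite /delta_tuple !tr_word_conj.
Qed.

Lemma nbhs_conj_tuple (A B : 'M[C]_3) (x : E) (N : set E) :
  nbhs (conj_tuple A B x) N -> nbhs x (conj_tuple A B @^-1` N).
Proof.
have lc := conj_tuple_linear (k := k) A B.
move=> HN; apply: (differentiable_continuous
  (strict_diff_differentiable (strict_diff_linear x lc))).
exact: HN.
Qed.

Lemma open_noncrit : open (~` @crit R k F gam).
Proof.
apply: open_cls => sigma /crit_cls nc.
by apply: filterS (near_goodHom (nbhs_noncritical nc)) => s /crit_cls.
Qed.

Lemma holomorphic_trace_map : holomorphic_on (~` @crit R k F gam) (@trace_map R k F gam).
Proof.
move=> rho _; exists (@traces R k).
  by apply: (@filterE _ _ (nbhs_filter _)) => a; exact: strict_diff_differentiable (strict_diff_traces a).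
by apply: (@filterE _ _ (nbhs_filter _)) => sigma; exact: trace_map_cls.
Qed.

Lemma chart_at (r : Rstar R gam) : (~` @crit R k F gam) r ->
  exists (U : set (Rstar R gam)) (V : set 'rV[C]_(8 * k - 8))
         (g : 'rV[C]_(8 * k - 8) -> Rstar R gam),
    [/\ [/\ open U, U r, U `<=` ~` @crit R k F gam & open V],
        [/\ set_fun U V (@trace_map R k F gam), set_fun V U g,
            {in U, cancel (@trace_map R k F gam) g} &
            {in V, cancel g (@trace_map R k F gam)}] &
        holomorphic_into V g].
Proof.
have [sigma0 ->] := clsP r => /crit_cls nc0.
set x0 := coord sigma0 in nc0.
have [S [V [oV V0 HS HN]]] := local_chart k3 (sl_tuple_coords gam _) nc0.
pose G : set E := [set y | [/\ noncritical y, V (traces y) & sl_tuple y ->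
  exists A B, A * B = 1 /\ y = conj_tuple A B (S (traces y))]].
pose Nu := interior G.
have oN : open Nu by exact: open_interior.
have N0 : Nu x0.
  have := @filterI _ _ (nbhs_filter x0) _ _ HN (nbhs_noncritical nc0).
  by apply: filterS => y [[Vy Hy] ncy]; split.
have HNu y : Nu y -> G y by exact: interior_subset.
have sec v : V v -> exists sigma, coord sigma = S v.
  by move=> /HS[slS ncS _ _]; apply: goodHom_exists => //; exact: ltnW.
pose g v := if pselect (V v) is left Vv then cls (sval (cid (sec v Vv))) else cls sigma0.
have gE v : V v -> exists2 sigma, coord sigma = S v & g v = cls sigma.
  rewrite /g; case: pselect => // Vv _; exists (sval (cid (sec v Vv))) => //.
  exact: (svalP (cid (sec v Vv))).
(* The classes of tuples conjugate into [Nu]. By [UE] membership does not depend on the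
   representative, and [U] is open in the quotient because conjugation is continuous. *)
pose U := [set r' | exists sigma, r' = cls sigma /\
  exists A B, A * B = 1 /\ Nu (conj_tuple A B (coord sigma))].
have UE sigma : U (cls sigma) ->
    exists A B, A * B = 1 /\ Nu (conj_tuple A B (coord sigma)).
  move=> [tau [/esym /conj_cls[A [B [AB E']]] [A' [B' [AB' Oc]]]]].
  have BA : B * A = 1 by exact: mulmx1C.
  exists (A' * B), (A * B'); split.
    by rewrite mulrA -(mulrA A') BA mulr1.
  by rewrite -conj_tuple_comp E' conj_tupleK.
have oU : open U.
  apply: open_cls => sigma /UE[A [B [AB Oc]]].
  have := near_goodHom (nbhs_conj_tuple (open_nbhs_nbhs (conj oN Oc))).
  by apply: filterS => s Os; exists s; split=> //; exists A, B.
have Uf r' : U r' -> V (trace_map r') /\ g (trace_map r') = r'.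
  move=> [sigma [-> [A [B [AB /HNu[ncy Vy Hy]]]]]].
  have slx := sl_tuple_coords gam (ghom sigma).
  have sly := sl_tuple_conj AB slx.
  move: Vy Hy; rewrite traces_conj// trace_map_cls// => Vy /(_ sly)[A' [B' [AB' E']]].
  split=> //; have [tau tauS ->] := gE _ Vy.
  apply: (@cls_conj R k F gam free_gam tau sigma (B * A') (B' * A)).
    by rewrite mulrA -(mulrA B) AB' mulr1; exact: mulmx1C.
  by rewrite tauS -conj_tuple_comp -E' conj_tupleK.
have gU v : V v -> trace_map (g v) = v.
  by move=> Vv; have [sigma sS ->] := gE v Vv; rewrite trace_map_cls// sS; have [] := HS v Vv.
have cS v : V v -> {for v, continuous S}.
  by move=> /HS[_ _ _ dS]; exact: differentiable_continuous.
have cg v : V v -> {for v, continuous g}.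
  move=> Vv W; have [sigma sS ->] := gE v Vv => HW.
  have [N nN HNW] := nbhs_goodHom (cls_continuous HW).
  rewrite sS in nN; have nv := @filterI _ _ (nbhs_filter v) _ _ (open_nbhs_nbhs (conj oV Vv)) (cS v Vv _ nN).
  apply: filterS nv => w [Vw NSw] /=; have [tau tS ->] := gE w Vw.
  by apply: HNW; rewrite tS.
(* [g] may send points of [V] outside [U]; the restriction makes [trace_map] and [g] inverse
   bijections between [U] and [V']. *)
pose V' := V `&` g @^-1` U.
have oV' : open V'.
  rewrite openE => v [Vv Ugv]; apply: filterI; first exact: open_nbhs_nbhs.
  by apply: (cg v Vv); exact: open_nbhs_nbhs.
exists U, V', g; split; first split.
- exact: oU.
- exists sigma0; split=> //; exists 1, 1; split; first exact: mulr1.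
  suff -> : conj_tuple 1 1 (coord sigma0) = x0 by [].
  by apply/row_matrixP => i; rewrite rowK mul1mx mulmx1 vec_mxK.
- move=> r' [sigma [-> [A [B [AB /HNu[ncy _ _]]]]]]; apply/crit_cls.
  exact: noncritical_conj AB (sl_tuple_coords gam _) ncy.
- exact: oV'.
- split.
  + by move=> r' Ur; have [Vr gr] := Uf r' Ur; split=> //=; rewrite gr.
  + by move=> v [].
  + by move=> r' /set_mem /Uf[].
  + by move=> v /set_mem[Vv _]; exact: gU.
split; first by move=> v /set_mem[Vv _]; exact: cg.
(* Near [v], the map [f \o g] is [f' \o S], where [f'] is the local extension of [f \o cls] to
   matrices. *)
move=> W f oW hf v [Vv _] Wg; have [sigma sS gv] := gE v Vv.
rewrite gv in Wg; have [f' df' ff'] := hf sigma Wg.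
have [N nN HNf] := nbhs_goodHom ff'.
rewrite sS in nN df'.
have [_ _ _ dS] := HS v Vv.
apply: (@differentiable_near_eq R _ _ (f' \o S)).
  by apply: differentiable_comp => //; exact: nbhs_singleton df'.
apply: filterS (@filterI _ _ (nbhs_filter v) _ _ (open_nbhs_nbhs (conj oV Vv)) (cS v Vv _ nN)) => w [Vw NSw] /=.
have [tau tS ->] := gE w Vw.
by rewrite -tS; apply/esym; apply: HNf; rewrite tS.
Qed.

End Chart.

Theorem proposition6 (R : realType) (k : nat) (hk : (3 <= k)%N)
    (F : groupType) (gam : k.-tuple F) (free_gam : free_basis gam) :
  local_parameterization (~` @crit R k F gam) (@trace_map R k F gam).
Proof.
split; first exact: open_noncrit.
- exact: holomorphic_trace_map.
- by move=> r; exact: chart_at.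
Qed.
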